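(* Let $M$ be a connected compact topological manifold, possibly with boundary, and let $\varphi$ be a continuous flow on $M$. Assume that the cone $\mathrm{QL}_\varphi\subset H^1(M,\mathbb R)$ of quasi-Lyapunov classes is closed and polyhedral. Then for every face $F$ of $\mathrm{QL}_\varphi$ there exists a $\varphi$-invariant compact subset $\mathcal R_F\subset M$ such that: (1) for every quasi-Lyapunov class $\alpha$ in the (relative) interior of $F$, one has $\mathcal R_\alpha=\mathcal R_F$; (2) if $F'$ is a proper sub-face of $F$, then $\mathcal R_F$ is a proper subset of $\mathcal R_{F'}$.
   Context: Flows are defined for all times; $M$ carries a metric compatible with its topology. Coverings. $\widehat M\to M$ is the universal Abelian covering of $M$; its deck group is $H_1(M,\mathbb Z)$, and the action is written $\delta\cdot x$. A class $\alpha\in H^1(M,\mathbb R)$ is viewed as a homomorphism $H_1(M,\mathbb Z)\to\mathbb R$, with kernel $\ker_{\mathbb Z}(\alpha)$. Set $\widehat M_\alpha=\widehat M/\ker_{\mathbb Z}(\alpha)$, a covering $\pi_\alpha\colon\widehat M_\alpha\to M$. The flow lifts to $\widehat M$ and $\widehat M_\alpha$. Covering spaces of $M$ carry a metric invariant under deck transformations for which the projection to $M$ restricted to every ball of sufficiently small radius is an isometry onto its image. A function $f$ on $\widehat M$ is $\alpha$-equivariant if $f(\delta\cdot x)=f(x)+\alpha(\delta)$ for all $\delta\in H_1(M,\mathbb Z)$ and all $x$. Pseudo-orbits. Let $N$ be $M$ or one of these coverings, with its flow $\psi$ and metric $d$, and fix $T>0$. For $\epsilon>0$, an $\epsilon$-pseudo-orbit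 is a right-continuous map $\gamma\colon[0,l)\to N$, $l>0$ (the length $\mathrm{len}(\gamma)$), continuous outside a finite set $\Delta\subset[T,l)$ whose distinct points are at distance at least $T$ from each other, such that $\gamma(s)=\psi_{s-t}(\gamma(t))$ whenever $\gamma$ is continuous on $[t,s]$, and $d(\gamma(u),\gamma(u^-))<\epsilon$ for $u\in\Delta$, where $\gamma(u^-)=\lim_{t\to u^-}\gamma(t)$. It goes from $\gamma(0)$ to $\gamma(l^-)$. Write $x\rightsquigarrow y$ if for every $\epsilon>0$ there is an $\epsilon$-pseudo-orbit from $x$ to $y$. A point $x$ is recurrent if $x\rightsquigarrow x$. $\mathcal R_\alpha\subset M$ (the $\alpha$-recurrent set) is the image under $\pi_\alpha$ of the set of recurrent points of the lifted flow on $\widehat M_\alpha$. A continuous $\alpha$-equivariant map $f\colon\widehat M\to\mathbb R$ is quasi-Lyapunov if there are $C\ge0$ and $\epsilon>0$ such that $f(\gamma(0))\ge f(\gamma(t))-C$ for every $\epsilon$-pseudo-orbit $\gamma$ in $\widehat M$ and every $t\in[0,\mathrm{len}(\gamma))$. The class $\alpha$ is quasi-Lyapunov if every continuous $\alpha$-equivariant map $\widehat M\to\mathbb R$ is quasi-Lyapunov. $\mathrm{QL}_\varphi$ is the set of quasi-Lyapunov classes in $H^1(M,\mathbb R)$; it is a convex cone containing $0$. Faces of a closed polyhedral cone (of all dimensions, including the cone itself) are understood in the usual sense, and the interior of a face is its interior in its linear span. *)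

(* Defs.v *)
From HB Require Import structures.
From mathcomp.multinomials Require Import freeg.
From mathcomp Require Import all_boot all_order all_algebra.
From mathcomp Require Import all_classical all_reals all_analysis.

Set Implicit Arguments.
Unset Strict Implicit.
Unset Printing Implicit Defensive.

Import Order.TTheory GRing.Theory Num.Theory.
Import numFieldNormedType.Exports.

Local Open Scope classical_set_scope.
Local Open Scope ring_scope.

Section SingularHomology.
Variable R : realType.

Definition simplex n : set 'rV[R]_n.+1 :=
  [set v | (forall i, 0 <= v ord0 i) /\ \sum_i v ord0 i = 1].
Arguments simplex : clear implicits.

Definition vertex_val n (i : 'I_n.+1) : 'rV[R]_n.+1 := delta_mx ord0 i.

Lemma vertex_subproof n (i : 'I_n.+1) : simplex n (vertex_val i).
Proof.
split=> [j|]; first by rewrite mxE ler0n.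
rewrite (bigD1 i) //= mxE !eqxx big1 ?addr0 // => j ji.
by rewrite mxE (negbTE ji) andbF.
Qed.

Definition vertex n (i : 'I_n.+1) : simplex n :=
  SigSub (mem_set (vertex_subproof i)).

Definition face_val n (i : 'I_n.+2) (v : 'rV[R]_n.+1) : 'rV[R]_n.+2 :=
  \row_j (if unlift i j is Some k then v ord0 k else 0).

Lemma face_subproof n (i : 'I_n.+2) (v : simplex n) :
  simplex n.+1 (face_val i (val v)).
Proof.
case: v => v /= /set_mem [v0 v1]; split=> [j|].
  by rewrite mxE; case: unliftP.
rewrite (bigD1_ord i) //= mxE unlift_none add0r -[RHS]v1.
by apply: eq_bigr => j _; rewrite mxE liftK.
Qed.

Definition face n (i : 'I_n.+2) (v : simplex n) : simplex n.+1 :=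
  SigSub (mem_set (face_subproof i v)).

Lemma face_val_continuous n (i : 'I_n.+2) : continuous (@face_val n i).
Proof.
move=> v A [P vP PA].
exists (fun _ k => P ord0 (lift i k)).
  move=> j k; have := vP ord0 (lift i k).
  by rewrite mxE liftK (ord1 j).
move=> w wP; apply: PA => j k; rewrite (ord1 j).
have := vP ord0 k; rewrite !mxE; case: unliftP => [l ->|->] vPk.
  exact: wP.
exact: nbhs_singleton.
Qed.

Lemma face_continuous n (i : 'I_n.+2) : continuous (@face n i).
Proof.
apply: continuous_comp_initial => v.
apply: (@continuous_comp _ _ _ set_val (@face_val n i)).
  exact: initial_continuous.
exact: face_val_continuous.
Qed.

HB.instance Definition _ n (i : 'I_n.+2) :=
  @isContinuous.Build (simplex n) (simplex n.+1) (@face n i)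
    (@face_continuous n i).

Variable X : topologicalType.

Definition singular n := continuousType (simplex n) X.

Definition chain n := {freeg (singular n) / int}.

Definition singular_face n (i : 'I_n.+2) (s : singular n.+1) : singular n :=
  [the continuousType _ _ of s \o @face n i].

Definition boundary n : chain n.+1 -> chain n :=
  fglift (fun s => \sum_(i < n.+2)
    ((-1) ^+ i : int) *: (<< singular_face i s >> : chain n)).

Lemma boundaryB n : {morph @boundary n : c d / c - d}.
Proof. exact: lift_is_additive. Qed.

Lemma boundary0 n : boundary (0 : chain n.+1) = 0.
Proof. by have := boundaryB (0 : chain n.+1) 0; rewrite !subrr. Qed.

Definition is_cycle1 : {pred chain 1} := [pred c | boundary c == 0].

Lemma is_cycle1_closed : zmod_closed is_cycle1.
Proof.
split=> [|c d]; rewrite !inE; first by rewrite boundary0.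
by move=> /eqP c0 /eqP d0; rewrite boundaryB c0 d0 subrr.
Qed.

HB.instance Definition _ :=
  GRing.isZmodClosed.Build (chain 1) is_cycle1 is_cycle1_closed.

Record cycle1 := Cycle1 { cycle1_val :> chain 1; _ : cycle1_val \in is_cycle1 }.
HB.instance Definition _ := [isSub for cycle1_val].
HB.instance Definition _ := [Choice of cycle1 by <:].
HB.instance Definition _ := [SubChoice_isSubZmodule of cycle1 by <:].

Definition is_boundary1 : {pred cycle1} :=
  [pred c | `[< exists d : chain 2, boundary d = val c >]].

Lemma is_boundary1_closed : zmod_closed is_boundary1.
Proof.
split=> [|c d]; rewrite !unfold_in.
  apply/asboolP; exists 0.
  by rewrite boundary0; apply/esym/(raddf0 (val : {additive cycle1 -> _})).
move=> /asboolP[c' c'E] /asboolP[d' d'E]; apply/asboolP.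
exists (c' - d'); rewrite boundaryB c'E d'E.
exact/esym/(raddfB (val : {additive cycle1 -> _})).
Qed.

HB.instance Definition _ :=
  GRing.isZmodClosed.Build cycle1 is_boundary1 is_boundary1_closed.

Definition homology1 := Quotient.quot (is_boundary1 : zmodClosed cycle1).
HB.instance Definition _ := GRing.Zmodule.on homology1.

Definition homology_class (c : cycle1) : homology1 := (\pi_homology1 c)%qT.

Lemma singular_face0_eq (s : singular 1) :
  s (vertex ord0) = s (vertex ord_max) ->
  singular_face ord0 s = singular_face ord_max s.
Proof.
move=> s01; apply/continuousEP => v /=.
have v1 : val v ord0 ord0 = 1.
  by have [_] := set_mem (valP v); rewrite big_ord1.
have f0 : face ord0 v = vertex ord_max.
  apply/val_inj/rowP => j; rewrite !mxE /=.
  by case: unliftP => [k ->|->]; rewrite ?(ord1 k) ?v1 ?eqxx.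
have f1 : face ord_max v = vertex ord0.
  apply/val_inj/rowP => j; rewrite !mxE /=.
  by case: unliftP => [k ->|->]; rewrite ?(ord1 k) ?v1 ?eqxx.
by rewrite f0 f1.
Qed.

Lemma loop_is_cycle1 (s : singular 1) :
  s (vertex ord0) = s (vertex ord_max) -> (<< s >> : chain 1) \in is_cycle1.
Proof.
move=> s01; rewrite !inE /boundary liftU scale1r big_ord_recl big_ord1.
have -> : lift ord0 (ord0 : 'I_1) = ord_max :> 'I_2 by apply: val_inj.
by rewrite (singular_face0_eq s01) scale1r scaleN1r subrr.
Qed.

End SingularHomology.

Section Cohomology.
Variables (R : realType) (M : topologicalType).

Definition is_cohom1 : {pred homology1 R M -> R^o} :=
  [pred a | `[< {morph a : x y / x + y} >]].

Lemma is_cohom1_closed : submod_closed is_cohom1.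
Proof.
split=> [|k a b]; rewrite !unfold_in.
  by apply/asboolP => x y; rewrite addr0.
move=> /asboolP aD /asboolP bD; apply/asboolP => x y.
by rewrite !fctE aD bD scalerDr addrACA.
Qed.

HB.instance Definition _ := GRing.isSubmodClosed.Build R (homology1 R M -> R^o)
  is_cohom1 is_cohom1_closed.

(* H^1(M, R) identified with Hom(H_1(M, Z), R). *)
Record cohomology1 := Cohomology1 {
  cohom1_fun :> homology1 R M -> R^o;
  _ : cohom1_fun \in is_cohom1 }.
HB.instance Definition _ := [isSub for cohom1_fun].
HB.instance Definition _ := [Choice of cohomology1 by <:].
HB.instance Definition _ := [SubChoice_isSubLmodule of cohomology1 by <:].

(* Pointwise convergence on H_1(M, Z): the usual topology of the finite
   dimensional space H^1(M, R) when H_1(M, Z) is finitely generated. *)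
HB.instance Definition _ := Topological.copy cohomology1
  (initial_topology (cohom1_fun : cohomology1 -> {ptws homology1 R M -> R^o})).

End Cohomology.

Section Polyhedral.
Variables (R : realType) (V : lmodType R).

Definition polyhedral_cone (C : set V) : Prop :=
  exists (n : nat) (l : 'I_n -> {scalar V}),
    C = [set a | forall i, 0 <= l i a].

(* Since l = 0 is allowed, the cone is a face of itself. *)
Definition is_face (C F : set V) : Prop :=
  exists l : {scalar V},
    (forall a, C a -> 0 <= l a) /\ F = C `&` [set a | l a = 0].

Definition linear_span (A : set V) : set V :=
  [set v | exists (n : nat) (k : 'I_n -> R) (a : 'I_n -> V),
    (forall i, A (a i)) /\ v = \sum_i k i *: a i].

End Polyhedral.

Definition rel_interior (R : realType) (M : topologicalType)
    (F : set (cohomology1 R M)) : set (cohomology1 R M) :=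
  [set a | F a /\ \forall b \near within (linear_span F) (nbhs a), F b].

Section Manifold.
Variables (R : realType) (M : topologicalType).

(* For n = 0 the half-space is the whole (one-point) space. *)
Definition half_space n : set 'rV[R]_n :=
  [set v | forall i : 'I_n, i = 0%N :> nat -> 0 <= v ord0 i].
Arguments half_space : clear implicits.

Definition is_chart n (U : set M) (h : M -> 'rV[R]_n) : Prop :=
  [/\ open U, {within U, continuous h},
      (exists2 V, open V & h @` U = V `&` half_space n)
    & exists2 g : 'rV[R]_n -> M, {in U, cancel h g} &
        {within h @` U, continuous g}].

(* Hausdorffness and second countability are not required here: below, M is
   a compact metric space. *)
Definition manifold_with_boundary : Prop :=
  exists n, forall x : M, exists U (h : M -> 'rV[R]_n), U x /\ is_chart U h.

End Manifold.

Section Coverings.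
Variable R : realType.

Definition evenly_covered (E M : topologicalType) (p : E -> M) (U : set M) :=
  exists S : set (set E),
    [/\ p @^-1` U = \bigcup_(V in S) V,
        trivIset S id
      & forall V, S V -> [/\ open V, set_bij V U p &
          forall W, open W -> W `<=` V -> open (p @` W)]].

Definition covering_map (E M : topologicalType) (p : E -> M) : Prop :=
  continuous p /\
  forall x, exists U, [/\ open U, U x & evenly_covered p U].

Definition isometric_on_small_balls (E M : metricType R) (p : E -> M) : Prop :=
  exists2 r : R, 0 < r & forall x y z,
    ball x r y -> ball x r z -> mdist (p y) (p z) = mdist y z.

(* The covering is characterised by its monodromy: transport of the point
   over the origin of a loop is the action of the homology class of the loop.
   As the action is free, a loop lifts to a loop if and only if its class in
   H_1(M, Z) vanishes, i.e. the image of the fundamental group of the total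
   space is the commutator subgroup. *)
Record univ_abelian_cover (M : metricType R) := UnivAbelianCover {
  uac_space :> metricType R;
  uac_proj : continuousType uac_space M;
  uac_act : homology1 R M -> uac_space -> uac_space;
  uac_covering : covering_map uac_proj;
  uac_surj : set_surj setT setT uac_proj;
  uac_connected : connected [set: uac_space];
  uac_act0 : forall x, uac_act 0 x = x;
  uac_actD : forall c d x, uac_act (c + d) x = uac_act c (uac_act d x);
  uac_free : forall c x, uac_act c x = x -> c = 0;
  uac_fibre : forall x y,
    uac_proj x = uac_proj y <-> exists c, y = uac_act c x;
  uac_monodromy : forall (s : singular R uac_space 1)
      (loop : (uac_proj \o s) (vertex R ord0) =
              (uac_proj \o s) (vertex R ord_max)),
    s (vertex R ord_max) =
    uac_act (homology_class (Cycle1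
              (loop_is_cycle1 (s := [the continuousType _ _ of uac_proj \o s])
                 loop)))
      (s (vertex R ord0));
  uac_isometry : forall c x y, mdist (uac_act c x) (uac_act c y) = mdist x y;
  uac_local_isometry : isometric_on_small_balls uac_proj }.

(* The quotient by the integral kernel of a, with the quotient topology; the
   deck group of its projection to M is the quotient of H_1(M, Z) by that
   kernel, hence the form of the invariance of the metric. *)
Record cover_mod_ker (M : metricType R) (Mh : univ_abelian_cover M)
    (a : cohomology1 R M) := CoverModKer {
  cmk_space :> metricType R;
  cmk_quot : Mh -> cmk_space;
  cmk_proj : cmk_space -> M;
  cmk_surj : set_surj setT setT cmk_quot;
  cmk_quotE : forall x y, cmk_quot x = cmk_quot y <->
    exists2 c, a c = 0 & y = uac_act c x;
  cmk_open : forall U : set cmk_space, open U <-> open (cmk_quot @^-1` U);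
  cmk_projE : forall x, cmk_proj (cmk_quot x) = uac_proj Mh x;
  cmk_isometry : forall c x y,
    mdist (cmk_quot (uac_act c x)) (cmk_quot (uac_act c y)) =
    mdist (cmk_quot x) (cmk_quot y);
  cmk_local_isometry : isometric_on_small_balls cmk_proj }.

Arguments cmk_proj {M Mh a} _ _.

Record flow (N : topologicalType) := Flow {
  flow_fun :> R -> N -> N;
  flow_continuous : continuous (fun z : R * N => flow_fun z.1 z.2);
  flow0 : forall x, flow_fun 0 x = x;
  flowD : forall s t x, flow_fun (s + t) x = flow_fun s (flow_fun t x) }.

Definition lifts (N M : topologicalType) (p : N -> M) (psi : flow N)
    (phi : flow M) : Prop :=
  forall t x, p (psi t x) = phi t (p x).

Section PseudoOrbits.
Variables (N : metricType R) (psi : flow N) (T : R).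

(* Only the restriction of g to [0, l[ matters. *)
Definition pseudo_orbit (e l : R) (g : R -> N) : Prop :=
  0 < l /\ exists D : set R,
  [/\ finite_set D /\ D `<=` `[T, l[,
      forall u v, D u -> D v -> u != v -> T <= `|u - v|,
      (forall t, 0 <= t < l -> g s @[s --> t^'+] --> g t) /\
      (forall t, 0 < t < l -> ~ D t -> {for t, continuous g}),
      forall t s, 0 <= t <= s -> s < l -> {within `[t, s], continuous g} ->
        g s = psi (s - t) (g t)
    & forall u, D u ->
        exists2 z, g t @[t --> u^'-] --> z & mdist (g u) z < e].

Definition pseudo_connected (x y : N) : Prop :=
  forall e, 0 < e -> exists l g,
    [/\ pseudo_orbit e l g, g 0 = x & g t @[t --> l^'-] --> y].

Definition recurrent : set N := [set x | pseudo_connected x x].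

End PseudoOrbits.

Section QuasiLyapunov.
Variables (M : metricType R) (Mh : univ_abelian_cover M).
Variables (phih : flow Mh) (T : R).

Definition equivariant (a : cohomology1 R M) (f : Mh -> R) : Prop :=
  forall c x, f (uac_act c x) = f x + a c.

Definition quasi_lyapunov_map (f : Mh -> R) : Prop :=
  exists C e, [/\ 0 <= C, 0 < e &
    forall l g, pseudo_orbit phih T e l g ->
      forall t, 0 <= t < l -> f (g t) - C <= f (g 0)].

Definition quasi_lyapunov : set (cohomology1 R M) :=
  [set a | forall f : Mh -> R, continuous f -> equivariant a f ->
    quasi_lyapunov_map f].

End QuasiLyapunov.

Definition alpha_recurrent (M : metricType R) (Mh : univ_abelian_cover M)
    (a : cohomology1 R M) (Ma : cover_mod_ker Mh a) (phia : flow Ma) (T : R) :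
    set M :=
  cmk_proj Ma @` recurrent phia T.

End Coverings.

Arguments cmk_proj {R M Mh a} _ _.

(* Main.v *)
Require Import Defs.
From mathcomp Require Import all_boot all_order all_algebra.
From mathcomp Require Import all_classical all_reals all_analysis.
From mathcomp Require Import zify ring lra.
Import Order.TTheory GRing.Theory Num.Theory.
Import numFieldNormedType.Exports.
Local Open Scope classical_set_scope.
Local Open Scope ring_scope.

Set Implicit Arguments.
Unset Strict Implicit.
Unset Printing Implicit Defensive.

(* Work in the universal Abelian covering, with chains of orbit pieces of
   duration in [T, 2T] joined by jumps of size < e; an e-loop from x to c.x has
   class c. A quasi-Lyapunov class is nonpositive on all e-loops for some e,
   and since the polyhedral cone QL is finitely generated, one e0 serves for
   all of QL. So each e0-loop gives a nonpositive linear form on QL, which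
   vanishes at a relative interior point of a face F only if it vanishes on F:
   hence R_F is the set of points lying on arbitrarily fine loops whose class
   vanishes on F.

   For strictness, fine chains are shadowed by walks in a finite graph, from
   which short loops can be removed; so a class which is nonpositive on the
   finitely many short loops is quasi-Lyapunov. If F' is a proper face of F, a
   perturbation of a generic point of F' then shows that the class c of some
   fine loop vanishes on F' but is negative somewhere on F. If R_F' were
   contained in R_F, this loop would run close to R_F, so that it could be
   followed backwards modulo classes vanishing on F, producing a fine loop of
   class -c modulo such classes, which is absurd. *)

(** * Metric spaces and chains *)

Section Metric.
Variable R : realType.

Lemma mdist_ltD (N : metricType R) (y x z : N) a b :
  mdist x y < a -> mdist y z < b -> mdist x z < a + b.
Proof.
by move=> xy yz; apply: le_lt_trans (metric_triangle x y z) _; exact: ltrD.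
Qed.

Lemma nbhs_mdistP (N : metricType R) (x : N) (A : set N) :
  nbhs x A <-> exists2 d, 0 < d & forall y, mdist x y < d -> A y.
Proof.
split=> [/nbhs_ballP[d /= d0 dA]|[d d0 dA]].
  by exists d => // y xy; apply: dA; rewrite ballEmdist.
by apply/nbhs_ballP; exists d => //= y; rewrite ballEmdist; exact: dA.
Qed.

Lemma cvg_mdistP (I : Type) (F : set_system I) (FF : Filter F)
    (N : metricType R) (f : I -> N) (y : N) :
  f @ F --> y <-> forall e, 0 < e -> \forall t \near F, mdist y (f t) < e.
Proof.
split=> [fy e e0|fy A /nbhs_mdistP[e e0 eA]]; first by
  apply: (fy [set w | mdist y w < e]); apply/nbhs_mdistP; exists e.
by apply: filterS (fy e e0) => t; exact: eA.
Qed.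

Lemma seq_pos (I : eqType) (s : seq I) (P : I -> R -> Prop) :
  (forall i e e', 0 < e' -> e' <= e -> P i e -> P i e') ->
  (forall i, i \in s -> exists2 e, 0 < e & P i e) ->
  exists2 e, 0 < e & forall i, i \in s -> P i e.
Proof.
move=> Pmono; elim: s => [_|i s IH sP]; first by exists 1.
have [j js|e e0 eP] := IH; first by apply: sP; rewrite inE js orbT.
have [|d d0 dP] := sP i; first by rewrite inE eqxx.
exists (Num.min d e) => [|j]; first by rewrite lt_min d0.
have m0 : 0 < Num.min d e by rewrite lt_min d0.
rewrite inE => /orP[/eqP ->|js].
  by apply: Pmono dP => //; rewrite ge_min lexx.
by apply: Pmono (eP _ js) => //; rewrite ge_min lexx orbT.
Qed.

Lemma seq_bound (I : eqType) (s : seq I) (P : I -> R -> Prop) :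
  (forall i e e', e <= e' -> P i e -> P i e') ->
  (forall i, i \in s -> exists e, P i e) ->
  exists2 e, 0 <= e & forall i, i \in s -> P i e.
Proof.
move=> Pmono; elim: s => [_|i s IH sP]; first by exists 0.
have [j js|e e0 eP] := IH; first by apply: sP; rewrite inE js orbT.
have [|d dP] := sP i; first by rewrite inE eqxx.
exists (Num.max d e) => [|j]; first by rewrite le_max e0 orbT.
rewrite inE => /orP[/eqP ->|js].
  by apply: Pmono dP => //; rewrite le_max lexx.
by apply: Pmono (eP _ js) => //; rewrite le_max lexx orbT.
Qed.

End Metric.

(** * Paths of a relation *)

Fixpoint reach (X : Type) (P : X -> X -> Prop) n x y : Prop :=
  if n is m.+1 then exists2 w, reach P m x w & P w y else x = y.

(** At least one step is required: if empty paths were allowed, every point would be recurrent. *)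
Definition linked (X : Type) (P : X -> X -> Prop) x y : Prop :=
  exists n, reach P n.+1 x y.

Lemma reachD (X : Type) (P : X -> X -> Prop) m n x y z :
  reach P m x y -> reach P n y z -> reach P (m + n) x z.
Proof.
move=> xy; elim: n z => [z <-|n IH z [w yw wz]]; first by rewrite addn0.
by rewrite addnS; exists w => //; exact: IH.
Qed.

Lemma reachSl (X : Type) (P : X -> X -> Prop) n x y :
  reach P n.+1 x y <-> exists2 w, P x w & reach P n w y.
Proof.
split=> [|[w xw wy]]; last first.
  by rewrite -add1n; apply: reachD wy; exists x.
elim: n y => [y [w <- xw]|n IH y [w /IH[v xv vw] wy]]; first by exists y.
by exists v => //; exists w.
Qed.

(** All vertices of a path are named at once, so that the pigeonhole principle applies to them in
    [walk_bound]. *)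
Lemma reach_segment (Y : Type) (P : Y -> Y -> Prop) n x y : reach P n x y ->
  exists g : nat -> Y, [/\ g 0 = x, g n = y &
    forall i j, (i <= j)%N -> (j <= n)%N -> reach P (j - i) (g i) (g j)].
Proof.
elim: n y => [y <-|n IH y [w /IH[g [g0 gn gP]] wy]].
  by exists (fun=> x); split=> // i [|j] //; rewrite leqn0 => /eqP ->.
exists (fun i => if i == n.+1 then y else g i); split=> //; first by rewrite eqxx.
move=> i j ij; rewrite leq_eqVlt => /orP[/eqP jn|jn]; last first.
  by rewrite !ltn_eqF // ?(leq_ltn_trans ij) //; exact: gP.
rewrite jn eqxx; case: eqP => [->|/eqP i_n]; first by rewrite subnn.
have i_le : (i <= n)%N by rewrite -ltnS ltn_neqAle i_n -jn.
by rewrite subSn //; exists w => //; rewrite -gn; exact: gP.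
Qed.

Lemma reach_map (X Y : Type) (h : X -> Y) (P : X -> X -> Prop)
    (Q : Y -> Y -> Prop) n x y :
  (forall u v, P u v -> Q (h u) (h v)) -> reach P n x y ->
  reach Q n (h x) (h y).
Proof.
move=> PQ; elim: n y => [y <-//|n IH y [w /IH xw wy]].
by exists (h w) => //; exact: PQ.
Qed.

Lemma linked1 (X : Type) (P : X -> X -> Prop) x y : P x y -> linked P x y.
Proof. by move=> xy; exists 0%N, x. Qed.

Lemma linked_trans (X : Type) (P : X -> X -> Prop) y x z :
  linked P x y -> linked P y z -> linked P x z.
Proof.
by move=> [m xy] [n yz]; exists (m.+1 + n)%N; rewrite -addnS; exact: reachD yz.
Qed.

Lemma linked_reach (X : Type) (P : X -> X -> Prop) n y x z :
  linked P x y -> reach P n y z -> linked P x z.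
Proof.
by case: n => [xy <-//|n xy yz]; apply: linked_trans xy _; exists n.
Qed.

Lemma linked_map (X Y : Type) (h : X -> Y) (P : X -> X -> Prop)
    (Q : Y -> Y -> Prop) x y :
  (forall u v, P u v -> Q (h u) (h v)) -> linked P x y ->
  linked Q (h x) (h y).
Proof. by move=> PQ [n xy]; exists n; exact: reach_map xy. Qed.

Lemma linkedS (X : Type) (P Q : X -> X -> Prop) x y :
  (forall u v, P u v -> Q u v) -> linked P x y -> linked Q x y.
Proof. exact: (@linked_map _ _ id). Qed.

Section Step.
Variables (R : realType) (N : metricType R) (psi : flow R N) (T : R).

(* One step of a pseudo-orbit: times in [T, 2T] suffice, as longer pieces of
   orbit can be cut by jumps of size zero. *)
Definition step e x y : Prop :=
  exists t, [/\ T <= t, t <= 2 * T & mdist (psi t x) y < e].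

Definition chain e := linked (step e).

Lemma step_le e e' x y : e <= e' -> step e x y -> step e' x y.
Proof.
by move=> ee' [t [? ? xy]]; exists t; split=> //; exact: lt_le_trans ee'.
Qed.

Lemma chain_le e e' x y : e <= e' -> chain e x y -> chain e' x y.
Proof. by move=> ee'; apply: linkedS => u v; exact: step_le. Qed.

Lemma reach_le e e' n x y :
  e <= e' -> reach (step e) n x y -> reach (step e') n x y.
Proof.
by move=> ee'; apply: (reach_map (h := id)) => u v; exact: step_le.
Qed.

Lemma chain_long e t x y : 0 < T -> T <= t -> mdist (psi t x) y < e ->
  chain e x y.
Proof.
move=> T0 Tt xy; have e0 : 0 < e by apply: le_lt_trans xy; exact: mdist_ge0.
(* The bound starts at [2 * T], the longest duration of a single step. The induction cuts off pieces
   of duration exactly [T], and only while more than [2 * T] is left. *)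
have [n tn] : exists n : nat, t <= (n.+2)%:R * T.
  have b0 : 0 <= t / T by rewrite divr_ge0 // ltW // (lt_le_trans T0).
  exists (Num.bound (t / T)); rewrite -ler_pdivrMr //.
  apply: ltW; apply: lt_le_trans (archi_boundP b0) _.
  by rewrite ler_nat (leq_trans (leqnSn _)).
elim: n t x Tt xy tn => [|n IH] t x Tt xy tn.
  by apply: linked1; exists t.
have [t2|t2] := leP t (2 * T); first by apply: linked1; exists t.
apply: (@linked_trans _ _ (psi T x)).
  by apply: linked1; exists T; split; rewrite ?mdistxx //; lra.
apply: (IH (t - T)); first by lra.
  by rewrite -flowD subrK.
by rewrite lerBlDr; apply: le_trans tn _; rewrite [in leLHS]mulrSr mulrDl mul1r.
Qed.

End Step.

(** * Chains in a covering with a cocompact deck group *)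

Lemma connected_setT (X : topologicalType) (A : set X) :
  connected [set: X] -> A !=set0 -> open A -> closed A -> forall x, A x.
Proof.
move=> cX A0 oA cA x; suff -> : A = setT by [].
by apply: cX => //; exists A; rewrite ?setTI.
Qed.

Lemma open_mdistP (R : realType) (N : metricType R) (A : set N) :
  open A <-> forall x, A x -> exists2 d, 0 < d & forall y, mdist x y < d -> A y.
Proof.
rewrite openE; split=> [oA x /oA /nbhs_mdistP //|oA x /oA ?].
exact/nbhs_mdistP.
Qed.

Lemma open_mball (R : realType) (N : metricType R) (x : N) d :
  open [set y | mdist x y < d].
Proof.
apply/open_mdistP => y /= xy; exists (d - mdist x y); first by rewrite subr_gt0.
move=> z yz; rewrite -(subrKC (mdist x y) d).
by apply: le_lt_trans (metric_triangle x y z) _; rewrite ltrD2l.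
Qed.

(** Tube lemma: the times range over the compact interval [[- B, B]], so the neighbourhood of [z]
    can be chosen independently of the time. *)
Lemma flow_tube (R : realType) (N : metricType R) (psi : flow R N)
    (B e : R) (z : N) : 0 < e ->
  exists2 d, 0 < d & forall y t, mdist z y < d -> `|t| <= B ->
    mdist (psi t z) (psi t y) < e.
Proof.
move=> e0.
have /compact_near_coveringP cK := @segment_compact R (- B) B.
have : \forall y \near z,
    `[- B, B]%classic `<=` (fun t => mdist (psi t z) (psi t y) < e).
  apply: (cK _ _ (fun y t => mdist (psi t z) (psi t y) < e)) => t _.
  have e2 : 0 < e / 2 by rewrite divr_gt0.
  have /cvg_mdistP/(_ _ e2) := @flow_continuous _ _ psi (t, z).
  move=> -[[/= U V] [/= tU zV] UV].
  exists (U, V) => //= -[t' y] [/= Ut' Vy].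
  rewrite (splitr e); apply: (@mdist_ltD _ _ (psi t z)).
    by rewrite metric_sym; apply: (UV (t', z)); split=> //; exact: nbhs_singleton.
  by apply: (UV (t', y)).
move/nbhs_mdistP => [d d0 dK]; exists d => // y t zy tB.
by apply: (dK y zy); rewrite /= in_itv /= -ler_norml.
Qed.

(* [deck_cocompact] is compactness of the quotient, in the form of Lebesgue's
   covering lemma. *)
Record deck_action (R : realType) (X : metricType R) (H : zmodType) :=
    DeckAction {
  deck_act :> H -> X -> X;
  deck_act0 : forall x, deck_act 0 x = x;
  deck_actD : forall c d x, deck_act (c + d) x = deck_act c (deck_act d x);
  deck_isometry : forall c x y, mdist (deck_act c x) (deck_act c y) = mdist x y;
  deck_cocompact : forall eta : X -> R, (forall x, 0 < eta x) ->
    exists s : seq X, forall x,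
    exists z c, z \in s /\ mdist z (deck_act c x) < eta z;
  deck_radius : R;
  deck_radius_gt0 : 0 < deck_radius;
  deck_discrete : forall x c, mdist x (deck_act c x) < deck_radius -> c = 0 }.

Section Deck.
Variables (R : realType) (X : metricType R) (H : zmodType).
Variable act : deck_action X H.
Local Notation act0 := (deck_act0 act).
Local Notation actD := (deck_actD act).
Local Notation act_iso := (deck_isometry act).
Local Notation cocompact eta := (@deck_cocompact _ _ _ act eta).
Local Notation r := (deck_radius act).
Local Notation discr := (@deck_discrete _ _ _ act).

Let r_gt0 : 0 < r.
Proof. exact: deck_radius_gt0. Qed.

Lemma actK c : cancel (act c) (act (- c)).
Proof. by move=> x; rewrite -actD addNr act0. Qed.

Lemma actKV c : cancel (act (- c)) (act c).
Proof. by move=> x; rewrite -actD subrr act0. Qed.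

Lemma mdist_actl c x y : mdist (act c x) y = mdist x (act (- c) y).
Proof. by rewrite -(act_iso c x) actKV. Qed.

Lemma act_unique c c' x : mdist (act c x) (act c' x) < r -> c = c'.
Proof.
rewrite mdist_actl -actD => /discr /eqP.
by rewrite addrC subr_eq0 => /eqP ->.
Qed.

(** Lebesgue number argument. The space itself need not be compact, but a deck-invariant property
    has to be checked near finitely many points only, and the smallest of the local scales works
    everywhere. *)
Lemma cocompact_unif (P : R -> X -> Prop) :
  (forall d d' x, 0 < d' -> d' <= d -> P d x -> P d' x) ->
  (forall d c x, P d x -> P d (act c x)) ->
  (forall z, exists2 d, 0 < d & forall y, mdist z y < d -> P d y) ->
  exists2 d, 0 < d & forall x, P d x.
Proof.
move=> Pmono Pact Ploc.
have /boolp.choice[eta etaP] : forall z, exists d, 0 < d /\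
    forall y, mdist z y < d -> P d y.
  by move=> z; have [d d0 dP] := Ploc z; exists d.
have [s sP] := cocompact _ (fun z => (etaP z).1).
have [d d0 dP] : exists2 d, 0 < d & forall z, z \in s ->
    forall y, mdist z y < eta z -> P d y.
  apply: (@seq_pos _ _ s (fun z d => forall y, mdist z y < eta z -> P d y)).
    by move=> z d d' d'0 dd' zP y /zP; exact: Pmono.
  by move=> z _; exists (eta z); [exact: (etaP z).1 | exact: (etaP z).2].
exists d => // x; have [z [c [zs zc]]] := sP x.
by rewrite -(actK c x); apply: Pact; exact: dP zc.
Qed.

(** * Equivariant flows and recurrence modulo classes *)

Variables (phi : flow R X) (T : R).
Hypothesis T_gt0 : 0 < T.
Hypothesis phi_act : forall t c x, phi t (act c x) = act c (phi t x).

Local Notation step := (step phi T).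
Local Notation chain := (chain phi T).

Lemma flow_unif B e : 0 < e ->
  exists2 d, 0 < d & forall x y t, mdist x y < d -> `|t| <= B ->
    mdist (phi t x) (phi t y) < e.
Proof.
move=> e0; have e2 : 0 < e / 2 by rewrite divr_gt0.
apply: (cocompact_unif (P := fun d x => forall y t, mdist x y < d -> `|t| <= B ->
    mdist (phi t x) (phi t y) < e)) => [d d' x d'0 dd' dP y t xy|d c x dP y t|z].
- by apply: dP; exact: lt_le_trans xy dd'.
- move=> xy tB; rewrite phi_act mdist_actl -phi_act; apply: dP => //.
  by rewrite -mdist_actl.
have [d d0 dP] := flow_tube phi B z e2.
exists (d / 2) => [|x zx y t xy tB]; first by rewrite divr_gt0.
rewrite (splitr e); apply: (@mdist_ltD _ _ (phi t z)).
  by rewrite metric_sym; apply: dP => //; apply: lt_le_trans zx _; lra.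
by apply: dP => //; rewrite (splitr d); exact: mdist_ltD xy.
Qed.

Lemma flow_short e : 0 < e ->
  exists2 d, 0 < d & forall x s, `|s| < d -> mdist x (phi s x) < e.
Proof.
move=> e0; have e2 : 0 < e / 2 by rewrite divr_gt0.
apply: (cocompact_unif (P := fun d x => forall s, `|s| < d ->
    mdist x (phi s x) < e)) => [d d' x d'0 dd' dP s sd|d c x dP s sd|z].
- by apply: dP; exact: lt_le_trans dd'.
- by rewrite phi_act act_iso; exact: dP.
have /cvg_mdistP/(_ _ e2) := @flow_continuous _ _ phi (0, z).
move=> -[[/= U V] [/= /nbhs_ballP[d1 /= d10 d1U] /nbhs_mdistP[d2 d20 d2V]] UV].
have {}UV s y : `|s| < d1 -> mdist z y < d2 -> mdist z (phi s y) < e / 2.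
  move=> sd zy; have := UV (s, y); rewrite /= flow0; apply; split=> /=.
    by apply: d1U; rewrite -ball_normE /= sub0r normrN.
  exact: d2V.
exists (Num.min d1 d2) => [|x zx s]; first by rewrite lt_min d10.
rewrite lt_min => /andP[sd1 sd2].
have {}zx : mdist z x < d2 by apply: lt_le_trans zx _; rewrite ge_min lexx orbT.
rewrite (splitr e); apply: (@mdist_ltD _ _ z); last exact: UV.
by rewrite metric_sym -(flow0 phi x); apply: UV; rewrite ?normr0.
Qed.

Lemma step_act e c x y : step e x y -> step e (act c x) (act c y).
Proof. by move=> [t [? ? xy]]; exists t; split=> //; rewrite phi_act act_iso. Qed.

Lemma chain_act e c x y : chain e x y -> chain e (act c x) (act c y).
Proof. by apply: linked_map => u v; exact: step_act. Qed.

Lemma chain_loopD e x c d :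
  chain e x (act c x) -> chain e x (act d x) -> chain e x (act (c + d) x).
Proof.
move=> xc xd; apply: linked_trans xc _.
by rewrite actD; exact: chain_act.
Qed.

Lemma chain_loopMn e x c n : chain e x (act c x) -> chain e x (act (c *+ n.+1) x).
Proof.
by move=> xc; elim: n => [//|n IH]; rewrite mulrSr; exact: chain_loopD.
Qed.

(** Translation by [d] conjugates the class of the loop, and [H] is commutative. *)
Lemma chain_loop_act e x c d :
  chain e x (act c x) -> chain e (act d x) (act c (act d x)).
Proof. by move=> /(chain_act d); rewrite -!actD addrC. Qed.

Lemma step_unif e : 0 < e -> exists2 d, 0 < d & forall e1 x x' y y',
  step e1 x y -> mdist x x' < d -> mdist y y' < d -> step (e1 + e) x' y'.
Proof.
move=> e0; have e2 : 0 < e / 2 by rewrite divr_gt0.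
have [d d0 dP] := flow_unif (2 * T) e2.
exists (Num.min d (e / 2)) => [|e1 x x' y y' [t [tT t2 xy]]].
  by rewrite lt_min d0.
rewrite !lt_min => /andP[xx _] /andP[_ yy]; exists t; split=> //.
rewrite (splitr e) addrA; apply: (@mdist_ltD _ _ y) => //.
rewrite addrC; apply: mdist_ltD xy; rewrite metric_sym; apply: dP => //.
by rewrite ger0_norm //; lra.
Qed.

(** Only the first and the last step are perturbed, so the loss [e] does not grow with the number of
    steps. In a chain of one step both ends move at once, which [step_unif] allows. *)
Lemma chain_unif e : 0 < e -> exists2 d, 0 < d & forall e1 x x' y y',
  chain e1 x y -> mdist x x' < d -> mdist y y' < d -> chain (e1 + e) x' y'.
Proof.
move=> e0; have [d d0 dP] := step_unif e0.
exists d => // e1 x x' y y' [[|n] [w]].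
  by move=> <- xy xx yy; apply: linked1; exact: dP xy _ _.
move=> /reachSl[v xv vw] wy xx yy; exists n.+1, w; last first.
  by apply: dP wy _ yy; rewrite mdistxx.
apply/reachSl; exists v; first by apply: dP xv xx _; rewrite mdistxx.
apply: (reach_map (h := id) _ vw) => a b.
by apply: step_le; lra.
Qed.

Lemma chain_flow e s : 0 < e -> exists2 d, 0 < d & forall x y,
  chain d x y -> chain e (phi s x) (phi s y).
Proof.
move=> e0; have [d d0 dP] := flow_unif `|s| e0.
exists d => // x y; apply: linked_map => u v [t [tT t2 uv]].
by exists t; split=> //; rewrite -flowD addrC flowD; exact: dP.
Qed.

(** When [K] is a subgroup this is chain recurrence of the image of [x] in the quotient by [K],
    expressed upstairs. The class may change with [e]. *)
Definition recurrent_mod (K : set H) (x : X) : Prop :=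
  forall e, 0 < e -> exists2 c, K c & chain e x (act c x).

Lemma recurrent_mod_flow K s x :
  recurrent_mod K x -> recurrent_mod K (phi s x).
Proof.
move=> xK e e0; have [d d0 dP] := chain_flow s e0.
have [c Kc xc] := xK d d0; exists c => //.
by rewrite -phi_act; exact: dP.
Qed.

Lemma recurrent_mod_act K c x : recurrent_mod K x -> recurrent_mod K (act c x).
Proof.
move=> xK e /xK[d Kd xd]; exists d => //; exact: chain_loop_act.
Qed.

Lemma recurrent_mod_closed K x :
  (forall d, 0 < d -> exists2 y, mdist x y < d & recurrent_mod K y) ->
  recurrent_mod K x.
Proof.
move=> xK e e0; have e2 : 0 < e / 2 by rewrite divr_gt0.
have [d d0 dP] := chain_unif e2.
have [y xy yK] := xK d d0; have [c Kc yc] := yK _ e2.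
exists c => //; rewrite (splitr e); apply: dP yc _ _.
  by rewrite metric_sym.
by rewrite act_iso metric_sym.
Qed.

(** If [z] is not recurrent, a fine loop with class in [K] at a nearby point could be moved to [z];
    so some neighbourhood of [z] carries no such loop below a certain scale. Cocompactness makes the
    scale uniform. *)
Lemma loop_near_recurrent K d : 0 < d -> exists2 e, 0 < e &
  forall x c, K c -> chain e x (act c x) ->
  exists2 w, recurrent_mod K w & mdist x w < d.
Proof.
move=> d0.
apply: (cocompact_unif (P := fun e x => forall c, K c -> chain e x (act c x) ->
  exists2 w, recurrent_mod K w & mdist x w < d))
  => [e e' x e'0 ee' eP c Kc xc|e g x eP c Kc xc|z].
- exact: eP Kc (chain_le ee' xc).
- have [|w wK xw] := eP c Kc.
    by have := chain_loop_act (- g) xc; rewrite actK.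
  by exists (act g w); [exact: recurrent_mod_act | rewrite act_iso].
have [zK|] := pselect (recurrent_mod K z).
  by exists d => // y zy c Kc _; exists z => //; rewrite metric_sym.
move=> /existsNP[e /not_implyP[e0 zN]].
have e2 : 0 < e / 2 by rewrite divr_gt0.
have [d' d'0 d'P] := chain_unif e2.
exists (Num.min d' (e / 2)) => [|y]; first by rewrite lt_min d'0.
rewrite lt_min => /andP[zy _] c Kc yc; exfalso; apply: zN; exists c => //.
rewrite (splitr e); apply: (d'P _ y z (act c y) (act c z)).
- by apply: chain_le yc; rewrite ge_min lexx orbT.
- by rewrite metric_sym.
- by rewrite act_iso metric_sym.
Qed.

(* A very fine chain shadows the orbit for a long time, so that one may leave
   a recurrent orbit at time [t] and still follow the chain home. *)
Lemma recurrent_return e : 0 < e -> exists2 d, 0 < d & forall x c t,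
  0 <= t -> t <= 2 * T -> chain d x (act c x) ->
  chain e (phi t x) (act (c *+ 3) x).
Proof.
move=> e0; have e2 : 0 < e / 2 by rewrite divr_gt0.
have [d1 d10 d1P] := flow_unif (2 * T) e2.
have q0 : 0 < Num.min d1 e / 2 by rewrite divr_gt0 // lt_min d10.
have [d2 d20 d2P] := flow_unif (2 * T) q0.
have [qd1 qe] : Num.min d1 e / 2 * 2 <= d1 /\ Num.min d1 e / 2 * 2 <= e.
  by rewrite divfK // !ge_min !lexx orbT.
set q := Num.min d1 e / 2 in q0 d2P qd1 qe.
exists (Num.min q d2) => [|x c t t0 t2]; first by rewrite lt_min q0.
have [dq dd2] : Num.min q d2 <= q /\ Num.min q d2 <= d2.
  by rewrite !ge_min !lexx orbT.
move: (Num.min q d2) dq dd2 => d dq dd2 [n xc].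
have c2c : reach (step d) n.+1 (act c x) (act (c *+ 2) x).
  by rewrite mulr2n actD; apply: reach_map xc => u v; exact: step_act.
have c3c : reach (step d) n.+1 (act (c *+ 2) x) (act (c *+ 3) x).
  have -> : c *+ 3 = c *+ 2 + c by rewrite mulrSr.
  rewrite (actD (c *+ 2) c).
  by apply: (reach_map (h := act (c *+ 2)) _ xc) => u v; exact: step_act.
(* Three copies of the loop contain at least three steps, of total duration at least [3 * T]. As [t]
   is at most [2 * T], the piece of orbit left after time [t] lasts at least [T]. *)
have := reachD (reachD xc c2c) c3c; rewrite !addnS !addSn.
move=> /reachSl[x1 [t1 [Tt1 tT1 xx1]]].
move=> /reachSl[x2 [t2' [Tt2 tT2 xx2]]].
move=> /reachSl[x3 [t3 [Tt3 tT3 xx3]]] x3c.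
have {}x3c := @reach_map _ _ id _ (step e) _ _ _ _ x3c.
apply: (linked_reach _ (x3c _)) => [|u v]; last by apply: step_le; lra.
apply: (@chain_long _ _ _ _ _ (t3 + (t2' + t1) - t)) => //.
  by lra.
rewrite -flowD subrK !flowD.
have y2 : mdist (phi t2' (phi t1 x)) x2 < d1.
  apply: (@lt_le_trans _ _ (q + d)); last by lra.
  apply: mdist_ltD xx2; apply: d2P; first exact: lt_le_trans xx1 dd2.
  by rewrite ger0_norm //; lra.
apply: (@lt_le_trans _ _ (e / 2 + d)); last by lra.
apply: mdist_ltD xx3; apply: d1P => //.
by rewrite ger0_norm //; lra.
Qed.

(* All points of a fine loop with class in [K'] are close to recurrent orbits,
   along which each step can be undone modulo [K]. *)
Lemma chain_reverse (K K' : set H) :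
  K 0 -> (forall c d, K c -> K d -> K (c + d)) ->
  (forall w, recurrent_mod K' w -> recurrent_mod K w) ->
  forall e, 0 < e -> exists2 d, 0 < d & forall x c, K' c ->
    chain d x (act c x) -> exists2 k, K k & chain e (act c x) (act k x).
Proof.
move=> K0 KD K'K e e0; have e2 : 0 < e / 2 by rewrite divr_gt0.
have [d d0 dP] := chain_unif e2.
have d2 : 0 < d / 2 by rewrite divr_gt0.
have [d1 d10 d1P] := flow_unif (2 * T) d2.
have m0 : 0 < Num.min d d1 by rewrite lt_min d0.
have [d3 d30 d3P] := loop_near_recurrent K' m0.
have [d4 d40 d4P] := recurrent_return e2.
have q0 : 0 < Num.min d3 (d / 2) by rewrite lt_min d30.
have [qd3 qd] : Num.min d3 (d / 2) <= d3 /\ Num.min d3 (d / 2) <= d / 2.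
  by rewrite !ge_min !lexx orbT.
exists (Num.min d3 (d / 2)) => // x c K'c; move: (Num.min _ _) qd3 qd q0.
move=> q qd3 qd q0 xc.
(* A step from [y] to [z] is undone with the help of a recurrent point [w] near [y]: its orbit
   passes close to [z], and [recurrent_return] leads from there to a translate of [w] by
   [k *+ 3]. *)
have back y z : chain q y (act c y) -> step q y z ->
    exists2 k, K k & chain e z (act k y).
  move=> yc [t [Tt tT yz]].
  have [w /K'K wK] := d3P y c K'c (chain_le qd3 yc).
  rewrite lt_min => /andP[yw1 yw2].
  have [k Kk wk] := wK _ d40; exists (k *+ 3); first by rewrite !mulrS; auto.
  have t0 : 0 <= t by lra.
  rewrite (splitr e); apply: dP (d4P w k t t0 tT wk) _ _; last first.
    by rewrite act_iso metric_sym.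
  rewrite (splitr d); apply: (@mdist_ltD _ _ (phi t y)).
    by rewrite metric_sym; apply: d1P => //; rewrite ger0_norm.
  exact: lt_le_trans yz qd.
(* The predecessor [w] of [y] must itself lie on a loop of class [c] before [back] applies. The
   induction therefore remembers that [y] leads on to [act c x], from where the translated initial
   part of the loop reaches [act c w]. *)
suff main n y : reach (step q) n.+1 x y ->
    linked (step q) y (act c x) \/ y = act c x ->
    exists2 k, K k & chain e y (act k x).
  by have [n xcn] := xc; exact: main xcn (or_intror erefl).
elim: n y => [|n IH] y [w xw wy] yc.
  by rewrite -xw in wy; exact: back wy.
have wc : linked (step q) w (act c x).
  by case: yc => [yc|<-]; [apply: linked_trans yc|]; exact: linked1.
have [|k Kk yk] := back w y _ wy.
  by apply: linked_trans wc _; apply: chain_act; exists n.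
have [k' Kk' wk'] := IH w xw (or_introl wc).
exists (k + k'); first exact: KD.
by rewrite actD; apply: linked_trans yk _; exact: chain_act.
Qed.

(** * Equivariant functions *)

Section Equivariant.
Variables (f : X -> R) (a : H -> R).
Hypothesis f_cont : continuous f.
Hypothesis aD : forall c d, a (c + d) = a c + a d.
Hypothesis f_act : forall c x, f (act c x) = f x + a c.

Let a0 : a 0 = 0.
Proof. by apply: (addrI (a 0)); rewrite -aD !addr0. Qed.

Let aN c : a (- c) = - a c.
Proof. by apply: (addrI (a c)); rewrite -aD !subrr a0. Qed.

Lemma equivariant_unif e : 0 < e -> exists2 d, 0 < d & forall x y,
  mdist x y < d -> `|f x - f y| < e.
Proof.
move=> e0; have e2 : 0 < e / 2 by rewrite divr_gt0.
apply: (cocompact_unif (P := fun d x => forall y, mdist x y < d ->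
  `|f x - f y| < e)) => [d d' x d'0 dd' dP y xy|d c x dP y xy|z].
- by apply: dP; exact: lt_le_trans xy dd'.
- rewrite -(actKV c y) (f_act c x) f_act opprD addrACA subrr addr0; apply: dP.
  by rewrite -mdist_actl.
have /cvgrPdist_lt/(_ _ e2)/nbhs_mdistP[d d0 dP] := @f_cont z.
exists (d / 2) => [|x zx y xy]; first by rewrite divr_gt0.
have zx' : `|f z - f x| < e / 2 by apply: dP; apply: lt_le_trans zx _; lra.
have zy : `|f z - f y| < e / 2.
  by apply: dP; rewrite (splitr d); exact: mdist_ltD xy.
rewrite (splitr e) -(subrKA (f z)); apply: le_lt_trans (ler_normD _ _) _.
by rewrite ltrD // distrC.
Qed.

(** Uniform continuity alone gives no bound at the fixed scale [r / 4], as close points need not be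
    joined by small jumps. Both points are compared with translates of net points; the class
    relating two close net points is unique, so finitely many pairs yield a common bound. *)
Lemma equivariant_bounded : exists2 C, 0 <= C & forall x y,
  mdist x y < r / 4 -> `|f x - f y| <= C.
Proof.
have [d d0 dP] := equivariant_unif ltr01.
have m0 : 0 < Num.min d (r / 8) by rewrite lt_min d0 divr_gt0.
have [s sP] := cocompact (fun=> Num.min d (r / 8)) (fun=> m0).
have [K K0 KP] : exists2 K, 0 <= K & forall z, z \in s ->
    forall w, w \in s -> forall c, mdist z (act c w) < r / 2 ->
    `|f z - f w| + `|a c| <= K.
  apply: (@seq_bound _ _ s (fun z K => forall w, w \in s -> forall c,
    mdist z (act c w) < r / 2 -> `|f z - f w| + `|a c| <= K)).
    by move=> z K K' KK' zK w ws c zw; apply: le_trans KK'; exact: zK.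
  move=> z _.
  have [w _|K _ KP] := @seq_bound R _ s (fun w K => forall c,
    mdist z (act c w) < r / 2 -> `|f z - f w| + `|a c| <= K)
    (fun w K K' KK' zK c zw => le_trans (zK c zw) KK'); last by exists K.
  have [[c zc]|zN] := pselect (exists c, mdist z (act c w) < r / 2); last first.
    by exists 0 => c zc; case: zN; exists c.
  exists (`|f z - f w| + `|a c|) => c' zc'.
  rewrite (@act_unique c c' w) // (splitr r); apply: mdist_ltD zc'.
  by rewrite metric_sym.
(* The summand [2] pays for the comparison of [x] and of [y] with net points, each costing less than
   [1]. *)
exists (2 + K) => [|x y xy]; first by rewrite addr_ge0.
have [z [c [zs]]] := sP x; have [w [g [ws]]] := sP y.
rewrite !lt_min => /andP[wy1 wy2] /andP[zx1 zx2].
have zw : mdist z (act (c - g) w) < r / 2.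
  rewrite (_ : r / 2 = r / 8 + (r / 4 + r / 8)); last by lra.
  apply: mdist_ltD zx2 _; rewrite mdist_actl -actD addKr.
  by apply: mdist_ltD xy _; rewrite metric_sym mdist_actl opprK.
have := KP z zs w ws _ zw; have := dP _ _ zx1; have := dP _ _ wy1.
rewrite !f_act aD aN => /ltW wy /ltW zx zwK.
have -> : f x - f y = (f w - (f y + a g)) + - (f z - (f x + a c)) +
   ((f z - f w) + - (a c - a g)) by ring.
apply: le_trans (ler_normD _ _) _; apply: lerD.
  apply: le_trans (ler_normD _ _) _; rewrite normrN.
  by rewrite (_ : 2 = 1 + 1) // lerD.
by apply: le_trans (ler_normD _ _) _; rewrite normrN.
Qed.

(** The piece of orbit is cut into [n] parts, with [n] independent of [x] and [t], each moving
    points by less than [r / 4]. *)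
Lemma equivariant_flow_bounded : exists2 C, 0 <= C & forall x t,
  0 <= t -> t <= 2 * T -> `|f (phi t x) - f x| <= C.
Proof.
have [C C0 CP] := equivariant_bounded.
have r4 : 0 < r / 4 by rewrite divr_gt0.
have [d d0 dP] := flow_short r4.
pose n := (Num.bound (2 * T / d)).+1.
have n0 : 0 < n%:R :> R by rewrite ltr0n.
have nd : 2 * T < d * n%:R.
  have b0 : 0 <= 2 * T / d by rewrite divr_ge0 ?ltW // mulr_gt0.
  rewrite [d * _]mulrC -ltr_pdivrMr //; apply: lt_le_trans (archi_boundP b0) _.
  by rewrite ler_nat.
exists (C *+ n) => [|x t t0 t2]; first exact: mulrn_wge0.
pose h := t / n%:R.
have hd : `|h| < d.
  rewrite ger0_norm; last by rewrite divr_ge0 // ltW.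
  by rewrite ltr_pdivrMr //; exact: le_lt_trans nd.
have -> : t = h *+ n by rewrite -mulr_natr divfK // gt_eqF.
move: hd; move: h => h hd; move: n {n0 nd} => n.
elim: n => [|n IH]; first by rewrite !mulr0n flow0 subrr normr0.
rewrite mulrS flowD -(subrKA (f (phi (h *+ n) x))).
apply: le_trans (ler_normD _ _) _; rewrite mulrS lerD //.
by rewrite distrC; apply: CP; exact: dP.
Qed.

End Equivariant.

(** Time is discretised: each target lies within [r / 2] of one of finitely many points
    [phi (h *+ k) x], and there is at most one translate of [z] that close to a given point. *)
Lemma finite_steps e x z : e <= r / 4 ->
  finite_set [set c | step e x (act c z)].
Proof.
move=> er; have r4 : 0 < r / 4 by rewrite divr_gt0.
have [d d0 dP] := flow_short r4.
pose h := d / 2; have h0 : 0 < h by rewrite divr_gt0.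
pose n := (Num.bound (2 * T / h)).
pose A k := [set c | mdist (phi (h *+ k) x) (act c z) < r / 2].
have Afin k : finite_set (A k).
  have [[c xc]|xN] := pselect (exists c, A k c); last first.
    by apply: (@sub_finite_set _ _ set0) => // c xc; case: xN; exists c.
  apply: (@sub_finite_set _ _ [set c]) => // c' xc'.
  apply: (@act_unique _ _ z); rewrite (splitr r); apply: mdist_ltD xc.
  by rewrite metric_sym.
apply: (@sub_finite_set _ _ (\bigcup_(k in `I_n) A k)); last first.
  by apply: bigcup_finite => [|k _].
move=> c [t [Tt tT xc]].
have th : 0 <= t / h by rewrite divr_ge0 // ltW // (lt_le_trans T_gt0).
have [k1 k2] : (Num.truncn (t / h))%:R <= t / h /\
    t / h < (Num.truncn (t / h)).+1%:R.
  by have /andP[] := truncn_itv th.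
exists (Num.truncn (t / h)).
  rewrite /= -(ltr_nat R); apply: le_lt_trans k1 _.
  have b0 : 0 <= 2 * T / h by rewrite divr_ge0 ?ltW // mulr_gt0.
  apply: le_lt_trans (archi_boundP b0).
  by rewrite ler_pM2r ?invr_gt0.
move: (Num.truncn _) k1 k2 => k; rewrite ler_pdivlMr // ltr_pdivrMr // => k1 k2.
rewrite /A /= (_ : r / 2 = r / 4 + r / 4); last by lra.
apply: mdist_ltD (lt_le_trans xc er).
rewrite -(subrK (h *+ k) t) flowD; apply: dP.
rewrite -[h *+ k]mulr_natl.
rewrite ger0_norm; last by rewrite subr_ge0.
move: k2; rewrite mulrSr mulrDl mul1r => k2.
by apply: (@lt_trans _ _ h); [lra | rewrite /h; lra].
Qed.

(** * Walks in the finite quotient graph *)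

Section Walks.
Variables (s : seq X) (e : R).
Hypothesis e_small : e <= r / 4.

Definition in_net y := exists z c, z \in s /\ y = act c z.
Definition net_step x y := step e x y /\ in_net y.

Lemma in_net_act c y : in_net y -> in_net (act c y).
Proof. by move=> [z [d [zs ->]]]; exists z, (c + d); rewrite actD. Qed.

Lemma net_step_act c x y : net_step x y -> net_step (act c x) (act c y).
Proof. by move=> [xy /(in_net_act c)]; split=> //; exact: step_act. Qed.

Lemma finite_walks n x : finite_set [set y | reach net_step n x y].
Proof.
elim: n => [|n IH].
  by apply: (@sub_finite_set _ _ [set x]) => // y /= ->.
apply: (@sub_finite_set _ _ (\bigcup_(w in [set y | reach net_step n x y])
    \bigcup_(z in [set` s]) ((act^~ z) @` [set c | step e w (act c z)]))).
  move=> y [w xw [wy [z [c [zs yE]]]]]; exists w => //; exists z => //.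
  by exists c => //=; rewrite -yE.
apply: bigcup_finite => // w _; apply: bigcup_finite => [|z _].
  exact: finite_seq.
by apply: finite_image; exact: finite_steps.
Qed.

Definition short_loop_classes : set H :=
  [set c | exists z n,
    [/\ z \in s, (n < size s)%N & reach net_step n.+1 z (act c z)]].

(** Finitely many walks of bounded length start at each vertex, and the endpoint [act c z]
    determines [c]. *)
Lemma finite_short_loop_classes : finite_set short_loop_classes.
Proof.
apply: (@sub_finite_set _ _ (\bigcup_(z in [set` s]) \bigcup_(n in `I_(size s))
    ((act^~ z) @^-1` [set y | reach net_step n.+1 z y]))).
  by move=> c [z [n [zs ns zc]]]; exists z => //; exists n.
apply: bigcup_finite => [|z _]; first exact: finite_seq.
apply: bigcup_finite => // n _; apply: finite_preimage; last exact: finite_walks.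
move=> c d _ _ /= cd; apply: (@act_unique _ _ z).
by rewrite cd mdistxx.
Qed.

Lemma short_loop_classes_chain c : short_loop_classes c ->
  exists x, chain e x (act c x).
Proof.
move=> [z [n [_ _ zc]]]; exists z, n.
by apply: (reach_map (h := id) _ zc) => u v [].
Qed.

(* A walk longer than the number of vertices of the quotient graph contains
   a short loop, which may be removed without decreasing [f]. *)
Lemma walk_bound (f : X -> R) (a : H -> R) (B : R) :
  (forall c d, a (c + d) = a c + a d) ->
  (forall c x, f (act c x) = f x + a c) ->
  (forall c, short_loop_classes c -> a c <= 0) ->
  0 <= B -> (forall x y, step e x y -> f y <= f x + B) ->
  forall n x y, in_net x -> reach net_step n x y -> f y <= f x + B *+ (size s).
Proof.
move=> aD f_act aS B0 fB n x; elim/ltn_ind: n => n IH y xnet xy.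
have [ns|sn] := leqP n (size s).
  apply: (@le_trans _ _ (f x + B *+ n)); last by rewrite lerD2l ler_wpMn2l.
  elim: n y xy {IH ns} => [y <-|n IH y [w /IH xw [/fB wy _]]].
    by rewrite mulr0n addr0.
  by rewrite mulrSr addrA; apply: le_trans wy _; rewrite lerD2r.
have [g [g0 gn gP]] := reach_segment xy.
have gnet i : (i <= n)%N -> in_net (g i).
  case: i => [|i i_n]; first by rewrite g0.
  by have := gP i i.+1 (leqnSn _) i_n; rewrite subSn // subnn => -[w _ []].
have /boolp.choice[k kP] : forall i : 'I_(size s).+1, exists j : 'I_(size s),
    exists c, g i = act c (nth x s j).
  move=> i; have [|z [c [zs ->]]] := gnet i.
    by have := ltn_ord i; lia.
  rewrite -index_mem in zs; exists (Ordinal zs), c.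
  by rewrite /= nth_index // -index_mem.
(* Pigeonhole among the first [size s + 1] vertices of the walk; the loop found has at most [size s]
   steps. *)
have [i [j [ij kij]]] : exists i j : 'I_(size s).+1, (i < j)%N /\ k i = k j.
  have /injectiveP : ~~ injectiveb k.
    by apply/negP => /injectiveP/leq_card; rewrite !card_ord ltnn.
  move=> /existsNP[i /existsNP[j /not_implyP[kij ij]]].
  have [ij'|ji|ij'] := ltngtP i j; first by exists i, j.
    by exists j, i.
  by case: ij; exact: val_inj.
have [c gi] := kP i; have [d gj] := kP j.
rewrite kij in gi.
move: (nth _ _ _) gi gj (mem_nth x (ltn_ord (k j))) => z gi gj zs.
have jn : (j <= n)%N by have := ltn_ord j; lia.
have loop := gP i j (ltnW ij) jn.
have dc : a (d - c) <= 0.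
  apply: aS; exists z, (j - i).-1; split=> //.
    rewrite prednK ?subn_gt0 //; apply: leq_trans (leq_subr _ _) _.
    by rewrite -ltnS.
  have := reach_map (h := act (- c)) (fun u v => @net_step_act (- c) u v) loop.
  by rewrite prednK ?subn_gt0 // addrC actD gi gj actK.
have xi := gP 0%N i (leq0n _) (leq_trans (ltnW ij) jn).
rewrite subn0 g0 in xi.
have jy := gP j n jn (leqnn n); rewrite gn in jy.
(* The rest of the walk is translated so as to start at [g i]. It now ends at the translate of [y]
   by [c - d], where [f] is at least as large as at [y]. *)
have iy := reach_map (h := act (c - d)) (fun u v => @net_step_act (c - d) u v) jy.
rewrite gj -actD subrK -gi in iy.
have shorter : (i + (n - j) < n)%N by lia.
have := IH _ shorter _ xnet (reachD xi iy).
apply: le_trans; rewrite f_act lerDl -opprB.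
have a0 : a 0 = 0 by apply: (addrI (a 0)); rewrite -aD !addr0.
have -> : a (- (d - c)) = - a (d - c).
  by apply: (addrI (a (d - c))); rewrite -aD !subrr a0.
by rewrite oppr_ge0.
Qed.

End Walks.

(** A fine chain is shadowed by a walk between net points, to which [walk_bound] applies; [S] lists
    the classes of the short loops. Both [S] and [d] are chosen before [f] and [a]; only [C] depends
    on these. *)
Lemma loop_classes e : 0 < e -> exists2 S : seq H,
  (forall c, c \in S -> exists x, chain e x (act c x)) &
  exists2 d, 0 < d & forall (f : X -> R) (a : H -> R), continuous f ->
    (forall c d, a (c + d) = a c + a d) ->
    (forall c x, f (act c x) = f x + a c) ->
    (forall c, c \in S -> a c <= 0) ->
    exists2 C, 0 <= C & forall n x y, reach (step d) n x y -> f y <= f x + C.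
Proof.
move=> e0; pose e' := Num.min e (r / 4).
have e'0 : 0 < e' by rewrite lt_min e0 divr_gt0.
have e'r : e' <= r / 4 by rewrite ge_min lexx orbT.
have e'e : e' <= e by rewrite ge_min lexx.
have e2 : 0 < e' / 2 by rewrite divr_gt0.
have [d d0 dP] := step_unif e2.
have q0 : 0 < Num.min d (r / 4) by rewrite lt_min d0 divr_gt0.
have [s sP] := cocompact (fun=> Num.min d (r / 4)) (fun=> q0).
have /finite_seqP[S SE] := @finite_short_loop_classes s _ e'r.
have {}SE c : (c \in S) = `[< short_loop_classes s e' c >].
  by apply/idP/asboolP => [cS|]; [rewrite SE | rewrite SE].
exists S => [c|].
  rewrite SE => /asboolP /short_loop_classes_chain[x xc]; exists x.
  exact: chain_le xc.
exists (e' / 2) => // f a f_cont aD f_act aS.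
have [C0 C00 C0P] := equivariant_bounded f_cont aD f_act.
have [C1 C10 C1P] := equivariant_flow_bounded f_cont aD f_act.
have fstep x y : step e' x y -> f y <= f x + (C1 + C0).
  move=> [t [Tt tT xy]]; have t0 : 0 <= t by lra.
  have := C1P x t t0 tT; have := C0P _ _ (lt_le_trans xy e'r).
  by rewrite !ler_norml => /andP[? ?] /andP[? ?]; lra.
have C010 : 0 <= C1 + C0 by rewrite addr_ge0.
have aS' c : short_loop_classes s e' c -> a c <= 0.
  by move=> cS; apply: aS; rewrite SE; apply/asboolP.
have bound := walk_bound e'r aD f_act aS' C010 fstep.
exists (C0 + (C1 + C0) *+ size s + C0) => [|n x y xy].
  by rewrite !addr_ge0 // mulrn_wge0.
have near_net u : exists v, [/\ exists z c, z \in s /\ v = act c z,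
    mdist u v < d & `|f u - f v| <= C0].
  have [z [c [zs]]] := sP u; rewrite lt_min => /andP[zu1 zu2].
  exists (act (- c) z); split; first by exists z, (- c).
    by rewrite metric_sym mdist_actl opprK.
  by apply: C0P; rewrite metric_sym mdist_actl opprK.
have [x' [x'net xx' fx]] := near_net x.
suff [y' [yy' fy /(bound _ _ _ x'net)]] : exists y', [/\ mdist y y' < d,
    `|f y - f y'| <= C0 & reach (fun x y => step e' x y /\
      exists z c, z \in s /\ y = act c z) n x' y'].
  by move: fx fy; rewrite !ler_norml => /andP[? ?] /andP[? ?] ?; lra.
elim: n y xy => [y <-|n IH y [w /IH[w' [ww' _ xw']] wy]]; first by exists x'.
have [y' [y'net yy' fy]] := near_net y.
exists y'; split=> //; exists w' => //; split=> //.
by rewrite (splitr e'); exact: dP wy _ _.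
Qed.

Lemma mdist_continuous (p : X) : continuous (fun x => mdist x p).
Proof.
move=> x; apply/cvgrPdist_lt => e e0; apply/nbhs_mdistP; exists e => // y xy.
rewrite ltr_norml; apply/andP; split.
  by have := metric_triangle y x p; rewrite (metric_sym y x); lra.
by have := metric_triangle x y p; lra.
Qed.

(* A partition of unity subordinate to small balls, on each of which a deck
   transformation is singled out. *)
Lemma equivariant_exists (a : H -> R) : (forall c d, a (c + d) = a c + a d) ->
  exists2 f : X -> R, continuous f & forall c x, f (act c x) = f x + a c.
Proof.
move=> aD; pose q := r / 4; have q0 : 0 < q by rewrite divr_gt0.
have [s sP] := cocompact (fun=> q) (fun=> q0).
(* [k (z, x)] is the class of the only translate of [z] that can come within [q] of some point of
   the [q]-ball around [x]; [0] is a default for the case that no translate is near. *)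
have /boolp.choice[k kP] : forall zx : X * X, exists c, forall y,
    mdist zx.2 y < q -> forall c', mdist y (act c' zx.1) < q -> c' = c.
  move=> [z x] /=.
  have [[c xc]|xN] := pselect (exists c, mdist x (act c z) < q + q).
    exists c => y xy c' yc'; apply: (@act_unique _ _ z).
    rewrite (_ : r = (q + q) + (q + q)); last by rewrite /q; lra.
    by apply: mdist_ltD xc; rewrite metric_sym; exact: mdist_ltD yc'.
  by exists 0 => y xy c' yc'; case: xN; exists c'; exact: mdist_ltD yc'.
pose w0 z c x := Num.max 0 (q - mdist x (act c z)).
pose w z x := w0 z (k (z, x)) x.
have w0_eq0 z c x : q <= mdist x (act c z) -> w0 z c x = 0.
  by move=> xc; rewrite /w0 max_l // subr_le0.
(* For continuity at [x], the class is frozen at its value for [x]: it changes nearby only where the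
   weight vanishes. *)
have wE z x y (h : H -> R) : mdist x y < q ->
    w z y * h (k (z, y)) = w0 z (k (z, x)) y * h (k (z, x)).
  move=> xy; have [yk|yk] := ltP (mdist y (act (k (z, y)) z)) q.
    by rewrite /w (kP (z, x) y xy _ yk).
  have [yk'|yk'] := ltP (mdist y (act (k (z, x)) z)) q.
    rewrite /w -(kP (z, y) y _ _ yk') // mdistxx //.
  by rewrite /w !w0_eq0 // !mul0r.
have w_cont z (h : H -> R) : continuous (fun x => w z x * h (k (z, x))).
  move=> x; suff : {for x, continuous (fun y => w0 z (k (z, x)) y * h (k (z, x)))}.
    rewrite /prop_for /continuous_at -(wE z x x) ?mdistxx // => xc.
    apply: cvg_trans xc; apply: near_eq_cvg; apply/nbhs_mdistP.
    by exists q => // y xy; rewrite (wE z x).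
  apply: cvgM; last exact: cvg_cst.
  apply: (@continuous_max R X (fun=> 0)
    (fun y => q - mdist y (act (k (z, x)) z))); first exact: cvg_cst.
  by apply: cvgB; [exact: cvg_cst | exact: mdist_continuous].
have w_act z g x (h : H -> R) :
    w z (act g x) * h (k (z, act g x)) = w z x * h (g + k (z, x)).
  have [xk|xk] := ltP (mdist x (act (k (z, x)) z)) q.
    have gxk : mdist (act g x) (act (g + k (z, x)) z) < q by rewrite actD act_iso.
    have kE : g + k (z, x) = k (z, act g x).
      by apply: (kP (z, act g x) (act g x)) => //; rewrite mdistxx.
    by rewrite /w -kE /w0 actD act_iso.
  have [gxk|gxk] := ltP (mdist (act g x) (act (k (z, act g x)) z)) q.
    have xk' : mdist x (act (- g + k (z, act g x)) z) < q.
      by rewrite actD -mdist_actl.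
    have kE : - g + k (z, act g x) = k (z, x).
      by apply: (kP (z, x) x); rewrite ?mdistxx.
    by rewrite -kE in xk; have := lt_le_trans xk' xk; rewrite ltxx.
  by rewrite /w !w0_eq0 // !mul0r.
pose W x := \sum_(z <- s) w z x.
pose A x := \sum_(z <- s) w z x * a (k (z, x)).
have W_gt0 x : 0 < W x.
  have w_ge0 z y : 0 <= w z y by rewrite /w /w0 le_max lexx.
  have [z [c [zs zc]]] := sP x.
  have xc : mdist x (act (- c) z) < q by rewrite metric_sym mdist_actl opprK.
  rewrite /W (big_rem z) //= ltr_pwDl ?sumr_ge0 //.
  rewrite /w -(kP (z, x) x _ _ xc) ?mdistxx //.
  by rewrite /w0 lt_max subr_gt0 xc orbT.
have sum_cont (h : H -> R) :
    continuous (fun x => \sum_(z <- s) w z x * h (k (z, x))).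
  elim: s {sP W A W_gt0} => [|z s IH] x.
    by under eq_fun do rewrite big_nil; exact: cvg_cst.
  under eq_fun do rewrite big_cons.
  by apply: cvgD; [exact: w_cont | exact: IH].
have WE x : W x = \sum_(z <- s) w z x * (fun=> 1) (k (z, x)).
  by apply: eq_bigr => z _; rewrite mulr1.
have W_cont : continuous W.
  have -> : W = (fun x => \sum_(z <- s) w z x * (fun=> 1) (k (z, x))).
    by apply/funext => y; exact: WE.
  exact: (sum_cont (fun=> 1)).
(* This is the average of [a (k (z, x))] with weights [w z x]. Translation by [c] preserves the
   weights and adds [c] to each class of nonzero weight. *)
exists (fun x => A x / W x) => [x|c x].
  have W_neq0 : W x != 0 by rewrite gt_eqF.
  exact: (cvgM (sum_cont a x) (cvgV W_neq0 (W_cont x))).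
have -> : W (act c x) = W x.
  by rewrite !WE; apply: eq_bigr => z _; exact: (w_act z c x (fun=> 1)).
have -> : A (act c x) = A x + a c * W x.
  rewrite /A /W mulr_sumr -big_split /=; apply: eq_bigr => z _.
  by rewrite w_act aD mulrDr addrC (mulrC (a c)).
by rewrite mulrDl mulfK // gt_eqF.
Qed.

(* A loop closed by a last piece of orbit of arbitrary length [s]; repeating
   the loop takes care of periodic orbits of period less than [T]. *)
Lemma reach_flow_loop e : 0 < e -> exists2 d, 0 < d &
  forall n x w s c, reach (step d) n x w -> 0 < s -> phi s w = act c x ->
  exists k, chain e x (act (c *+ k.+1) x).
Proof.
move=> e0; have T0 := T_gt0; have [d d0 dP] := flow_unif T e0.
have m0 : 0 < Num.min d e by rewrite lt_min d0.
exists (Num.min d e) => // -[|n] x w s c.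
  move=> /= <- s0 sc.
  have scn k : phi (s *+ k) x = act (c *+ k) x.
    elim: k => [|k IH]; first by rewrite !mulr0n flow0 act0.
    by rewrite mulrSr flowD sc phi_act IH -actD mulrS.
  exists (Num.bound (T / s)).
  apply: (chain_long (t := s *+ (Num.bound (T / s)).+1)) => //.
    have b0 : 0 <= T / s by rewrite divr_ge0 // ltW.
    rewrite -mulr_natl -ler_pdivrMr // ltW //.
    apply: lt_le_trans (archi_boundP b0) _.
    by rewrite ler_nat.
  by rewrite scn mdistxx.
move=> [v xv vw] s0 sc; exists 0%N; rewrite mulr1n.
have {}xv : reach (step e) n x v.
  by apply: (reach_map (h := id) _ xv) => a b; apply: step_le; rewrite ge_min lexx orbT.
have linkl y z : reach (step e) n y z -> forall z', chain e z z' -> chain e y z'.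
  move=> yz z' [k zz']; exists (n + k)%N; rewrite -addnS; exact: reachD zz'.
have [t [Tt tT]] := vw; rewrite lt_min => /andP[vw1 vw2].
apply: linkl xv _ _; rewrite -sc.
(* A last piece shorter than [T] is not a step. It is joined to the preceding piece of orbit, and
   the jump between them is carried along by the flow, for a time at most [T]. *)
have [sT|Ts] := leP s T.
  apply: (chain_long (t := s + t)) => //; first by lra.
  by rewrite flowD; apply: dP => //; rewrite gtr0_norm.
apply: (@linked_trans _ _ w); first by apply: linked1; exists t.
by apply: (chain_long (t := s)) => //; [exact: ltW|rewrite mdistxx].
Qed.

(** The transition classes between neighbouring net points suffice. If [a] vanishes on them, the
    points close to a translate of the net by a class in the kernel of [a] form an open and closed
    set, hence the whole space. *)
Lemma finite_generation : connected [set: X] -> X -> exists s : seq H,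
  forall a : H -> R, (forall c d, a (c + d) = a c + a d) ->
  (forall c, c \in s -> a c = 0) -> forall c, a c = 0.
Proof.
move=> Xc x0.
have r4 : 0 < r / 4 by rewrite divr_gt0.
have [Z ZP] := cocompact (fun=> r / 4) (fun=> r4).
have /boolp.choice[k kP] : forall zw : X * X, exists c, forall c',
    mdist zw.1 (act c' zw.2) < r / 2 -> c' = c.
  move=> [z w] /=.
  have [[c zc]|zN] := pselect (exists c, mdist z (act c w) < r / 2); last first.
    by exists 0 => c' zc'; case: zN; exists c'.
  exists c => c' zc'; apply: (@act_unique _ _ w); rewrite (splitr r).
  by apply: mdist_ltD zc; rewrite metric_sym.
exists [seq k zw | zw <- [seq (z, w) | z <- Z, w <- Z]] => a aD a_gen.
have a0 : a 0 = 0 by apply: (addrI (a 0)); rewrite -aD !addr0.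
have aN c : a (- c) = - a c by apply: (addrI (a c)); rewrite -aD !subrr a0.
pose U := [set x | exists z c, [/\ z \in Z, mdist x (act c z) < r / 4 & a c = 0]].
have key z w c g x : z \in Z -> w \in Z -> mdist x (act c z) < r / 4 ->
    mdist x (act g w) < r / 4 -> a c = a g.
  move=> zZ wZ xc xg; have cg : mdist z (act (- c + g) w) < r / 2.
    rewrite actD -mdist_actl (_ : r / 2 = r / 4 + r / 4); last by lra.
    by apply: mdist_ltD xg; rewrite metric_sym.
  have : a (- c + g) = 0.
    rewrite (kP (z, w) _ cg); apply: a_gen; apply: map_f.
    by apply/allpairsP; exists (z, w).
  by rewrite aD aN => /eqP; rewrite addrC subr_eq0 => /eqP.
have near_net x : exists z c, z \in Z /\ mdist x (act c z) < r / 4.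
  have [z [c [zZ zc]]] := ZP x; exists z, (- c); split=> //.
  by rewrite metric_sym mdist_actl opprK.
have Uall : forall x, U x.
  apply: (@connected_setT _ U Xc).
  - have [z [_ [zZ _]]] := near_net x0.
    by exists z, z, 0; rewrite act0 mdistxx.
  - apply/open_mdistP => x [z [c [zZ xc ac]]].
    exists (r / 4 - mdist x (act c z)) => [|y xy]; first by rewrite subr_gt0.
    exists z, c; split=> //; have := metric_triangle y x (act c z).
    by rewrite (metric_sym y x); lra.
  rewrite -[X in closed X]setCK; apply: open_closedC.
  apply/open_mdistP => x xU; have [z [c [zZ xc]]] := near_net x.
  exists (r / 4 - mdist x (act c z)) => [|y xy]; first by rewrite subr_gt0.
  move=> [w [g [wZ yg ag]]]; apply: xU; exists z, c; split=> //.
  rewrite -ag; apply: (key z w c g y) => //.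
  by have := metric_triangle y x (act c z); rewrite (metric_sym y x); lra.
(* Both [act g z] and its translate by [c] are close to translates by classes in the kernel, so
   [key] gives [a g = 0] and [a (c + g) = 0]. *)
move=> c; have [z [g [zZ xg]]] := near_net x0.
have [w [h [wZ ch ah]]] := Uall (act c (act g z)).
have [w' [h' [w'Z gh' ah']]] := Uall (act g z).
have g0 : a g = 0.
  by rewrite -ah'; apply: (key z w' g h' (act g z)) => //; rewrite mdistxx.
have : a (c + g) = a h.
  by apply: (key z w _ _ (act c (act g z))) => //; rewrite actD mdistxx.
by rewrite aD g0 ah addr0.
Qed.

End Deck.

(** * Pseudo-orbits and chains *)

Section RealLimits.
Variables (R : realType) (N : metricType R).
Implicit Types (g : R -> N) (A : set R).

Lemma cvg_within_mdistP A g (u : R) (z : N) :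
  g @ within A (nbhs u) --> z <-> forall e, 0 < e -> exists2 d, 0 < d &
    forall s, `|s - u| < d -> A s -> mdist z (g s) < e.
Proof.
rewrite cvg_mdistP; split=> gz e /gz; rewrite near_withinE.
  move=> /nbhs_ballP[d /= d0 dP]; exists d => // s su; apply: dP.
  by rewrite -ball_normE /= distrC.
move=> [d d0 dP]; apply/nbhs_ballP; exists d => //= s.
by rewrite -ball_normE /= distrC; exact: dP.
Qed.

(** With half-lines for [A1] and [A], this shifts left and right limits in time alike. *)
Lemma cvg_within_shift A1 A g1 g (h u d : R) (z : N) : 0 < d ->
  (forall s, `|s - (u + h)| < d -> A s -> A1 (s - h) /\ g s = g1 (s - h)) ->
  g1 @ within A1 (nbhs u) --> z -> g @ within A (nbhs (u + h)) --> z.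
Proof.
move=> d0 dP /cvg_within_mdistP g1z; apply/cvg_within_mdistP => e /g1z.
move=> [d' d'0 d'P]; exists (Num.min d d') => [|s]; first by rewrite lt_min d0.
rewrite lt_min => /andP[sd sd'] As; have [As' ->] := dP s sd As.
by apply: d'P => //; rewrite -addrA -opprD (addrC h).
Qed.

Lemma cvg_within_eq A1 A g1 g (u d : R) (z : N) : 0 < d ->
  (forall s, `|s - u| < d -> A s -> A1 s /\ g s = g1 s) ->
  g1 @ within A1 (nbhs u) --> z -> g @ within A (nbhs u) --> z.
Proof.
move=> d0 dP g1z; rewrite -(addr0 u); apply: cvg_within_shift d0 _ g1z => s.
by rewrite addr0 subr0; exact: dP.
Qed.

Lemma flow_cvg (psi : flow R N) A (x : N) (u : R) :
  (fun s => psi s x) @ within A (nbhs u) --> psi u x.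
Proof.
apply/cvg_within_mdistP => e e0.
have /cvg_mdistP/(_ _ e0) := @flow_continuous _ _ psi (u, x).
move=> -[[/= U V] [/= /nbhs_ballP[d /= d0 dU] Vx] UV].
exists d => // s su _; apply: (UV (s, x)); split=> /=.
  by apply: dU; rewrite -ball_normE /= distrC.
exact: nbhs_singleton.
Qed.

Lemma flow_cvg_shift (psi : flow R N) A (x : N) (h u : R) :
  (fun s => psi (s - h) x) @ within A (nbhs u) --> psi (u - h) x.
Proof.
rewrite -{1}(subrK h u).
by apply: (cvg_within_shift (A1 := setT) (g1 := psi^~ x) (d := 1)) => //;
  exact: flow_cvg.
Qed.

(** Time [0] counts as an initial jump, so that there is always a last one. *)
Lemma last_before (s : seq R) (t : R) : 0 <= t -> exists v,
  [/\ v = 0 \/ v \in s, 0 <= v, v <= t &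
    forall u, u \in s -> u <= t -> u <= v].
Proof.
move=> t0; elim: s => [|u s [v [vs v0 vt vmax]]].
  by exists 0; split=> //; left.
have [/andP[ut vu]|uN] := boolP ((u <= t) && (v <= u)).
  exists u; split=> //; first by right; rewrite inE eqxx.
    exact: le_trans vu.
  move=> w; rewrite inE => /orP[/eqP -> //|ws wt].
  by apply: le_trans vu; exact: vmax.
exists v; split=> //.
  by case: vs => [->|vs]; [left|right; rewrite inE vs orbT].
move=> w; rewrite inE => /orP[/eqP -> ut|]; last exact: vmax.
by move: uN; rewrite ut /= -ltNge => /ltW.
Qed.

End RealLimits.

Section PseudoOrbitChains.
Variables (R : realType) (N : metricType R) (psi : flow R N) (T : R).
Hypothesis T_gt0 : 0 < T.
Local Notation step := (step psi T).
Local Notation chain := (chain psi T).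

(** * From pseudo-orbits to chains *)

Section FromPseudoOrbit.
Variables (e l : R) (g : R -> N).
Hypothesis gP : pseudo_orbit psi T e l g.

(** The flow relation is put in terms of jump times alone. A jump at [t] itself does no harm: by
    right continuity the path is still continuous on [[t, t']]. *)
Lemma pseudo_orbit_jumps : exists s : seq R,
  [/\ forall u, u \in s -> T <= u,
      forall u v, u \in s -> v \in s -> u != v -> T <= `|u - v|,
      forall t t', 0 <= t -> t <= t' -> t' < l ->
        (forall u, u \in s -> u <= t' -> u <= t) -> g t' = psi (t' - t) (g t) &
      forall u, u \in s -> u < l /\
        exists2 z, g t @[t --> u^'-] --> z & mdist (g u) z < e].
Proof.
have [l0 [D [[/finite_seqP[s DE] sub] sep [rc lc] flw jmp]]] := gP.
have {}DE u : (u \in s) = `[< D u >].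
  by apply/idP/asboolP => [us|]; [rewrite DE | rewrite DE].
have sl u : u \in s -> T <= u < l.
  by rewrite DE => /asboolP /sub; rewrite /= in_itv.
exists s; split.
- by move=> u /sl /andP[].
- by move=> u v; rewrite !DE => /asboolP Du /asboolP; exact: sep.
- move=> t t' t0 tt' t'l no; have [->|] := eqVneq t t'.
    by rewrite subrr flow0.
  move=> t_neq; have {t_neq} lt_tt' : t < t' by rewrite lt_neqAle t_neq.
  apply: flw => //; first by rewrite t0.
  apply/subspace_continuousP => u; rewrite /= in_itv /= => /andP[tu ut'].
  have u0l : 0 <= u < l by rewrite (le_trans t0) //= (le_lt_trans ut').
  have [ut|ut] := eqVneq u t.
    apply/cvg_within_mdistP => d d0.
    have /cvg_within_mdistP/(_ _ d0)[d' d'0 d'P] := rc u u0l.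
    exists d' => // w wu; rewrite /= in_itv /= -ut => /andP[+ _].
    rewrite le_eqVlt => /orP[/eqP <-|uw]; first by rewrite mdistxx.
    exact: d'P.
  have {ut} lt_tu : t < u by rewrite lt_neqAle eq_sym ut.
  have Du : ~ D u.
    by move=> /asboolP; rewrite -DE => /no /(_ ut'); rewrite leNgt lt_tu.
  have u0l' : 0 < u < l by rewrite (le_lt_trans t0) //= (le_lt_trans ut').
  by apply: cvg_trans (lc u u0l' Du); apply: cvg_app; exact: cvg_within.
- move=> u us; split; first by have /andP[] := sl u us.
  by apply: jmp; move: us; rewrite DE => /asboolP.
Qed.

(** [v] is the last jump up to time [t]. Jumps are at least [T] apart, so the orbit between two of
    them is a chain by [chain_long], and induction on the jump time in units of [T] joins these
    chains. *)
Lemma pseudo_orbit_reach_last t : 0 <= t -> t <= l -> exists v n,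
  [/\ 0 <= v, v <= t, v < l, reach (step e) n (g 0) (g v) &
    forall t', v <= t' -> t' <= t -> t' < l -> g t' = psi (t' - v) (g v)].
Proof.
move=> t0 tl; have [s [sT sep flw jmp]] := pseudo_orbit_jumps.
have l0 : 0 < l by case: gP.
have main n : forall v, v = 0 \/ v \in s -> v <= n%:R * T ->
    exists m, reach (step e) m (g 0) (g v).
  elim: n => [|n IH] v [->|vs] vn; try by exists 0%N.
    by exfalso; have := sT v vs; move: T_gt0 vn; rewrite mul0r; lra.
  have vT := sT v vs; have v0 : 0 < v by exact: lt_le_trans vT.
  have [vl [z gz zv]] := jmp v vs.
  pose s' := [seq u <- s | u < v].
  have [v' [v's' v'0 v'v v'max]] := last_before s' (ltW v0).
  have v'T : v' <= v - T.
    case: v's' => [->|]; first by rewrite subr_ge0.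
    rewrite mem_filter => /andP[v'lt v's].
    have := sep _ _ vs v's; rewrite gt_eqF // => /(_ isT).
    by rewrite gtr0_norm ?subr_gt0 // => ?; rewrite lerBrDl addrC -lerBrDl.
  have [||m v'm] := IH v'.
  - by case: v's' => [->|]; [left | rewrite mem_filter => /andP[_ ?]; right].
  - by move: vn; rewrite mulrSr mulrDl mul1r; lra.
  have zE : z = psi (v - v') (g v').
    apply: (cvg_unique (@metric_hausdorff _ N)) gz _.
    apply: (@cvg_within_eq _ _ (fun u => u < v) _
      (fun t => psi (t - v') (g v')) _ _ T) => //; last exact: flow_cvg_shift.
    move=> u; rewrite ltr_norml => /andP[uv _] lt_uv; split=> //.
    apply: flw => //; [lra|exact: lt_trans vl|].
    move=> w ws wu; apply: v'max; rewrite ?mem_filter ?ws ?andbT; lra.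
  have vv' : linked (step e) (g v') (g v).
    by apply: (chain_long (t := v - v')) => //; [lra | rewrite -zE metric_sym].
  have [k vk] := vv'; exists (m + k.+1)%N; exact: reachD vk.
have [v [vs v0 vt vmax]] := last_before s t0.
have vl : v < l.
  by case: vs => [->//|/jmp[]].
have [k vk] : exists n : nat, v <= n%:R * T.
  exists (Num.bound (v / T)); rewrite -ler_pdivrMr //; apply: ltW.
  by apply: archi_boundP; rewrite divr_ge0 // ltW.
have [m vm] := main k v vs vk; exists v, m; split=> // t' vt' t't t'l.
by apply: flw => // u us ut'; apply: vmax => //; exact: le_trans t't.
Qed.

Lemma pseudo_orbit_reach t : 0 < e -> 0 <= t -> t < l -> exists n y s,
  [/\ reach (step e) n (g 0) y, 0 <= s, s <= 2 * T & g t = psi s y].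
Proof.
move=> e0 t0 tl; have [v [n [v0 vt _ vn vP]]] := pseudo_orbit_reach_last t0 (ltW tl).
have gt := vP t vt (lexx t) tl.
have [t2|t2] := leP (t - v) (2 * T).
  by exists n, (g v), (t - v); rewrite subr_ge0.
have [||k vk] := @chain_long _ _ psi T e (t - v) (g v) (g t) T_gt0 _ _.
- by move: T_gt0; lra.
- by rewrite -gt mdistxx.
exists (n + k.+1)%N, (g t), 0; rewrite flow0; split=> //.
  exact: reachD vk.
by move: T_gt0; lra.
Qed.

Lemma pseudo_orbit_reach_end y : g t @[t --> l^'-] --> y -> exists n w s,
  [/\ reach (step e) n (g 0) w, 0 < s & y = psi s w].
Proof.
move=> gy; have l0 : 0 < l by case: gP.
have [v [n [v0 _ vl vn vP]]] := pseudo_orbit_reach_last (ltW l0) (lexx l).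
exists n, (g v), (l - v); rewrite subr_gt0; split=> //.
apply: (cvg_unique (@metric_hausdorff _ N)) gy _.
apply: (@cvg_within_eq _ _ (fun u => u < l) _ (fun t => psi (t - v) (g v))
  _ _ (l - v)) => [|u|]; [by rewrite subr_gt0| |exact: flow_cvg_shift].
rewrite ltr_norml => /andP[uv _] ul; split=> //.
by apply: vP => //; [lra | exact: ltW].
Qed.

End FromPseudoOrbit.

(** * From chains to pseudo-orbits *)

Section ToPseudoOrbit.
Variable e : R.

(* The invariant of a pseudo-orbit built jump by jump. At jump times [D] the
   left limit is only required to be close to the value. *)
Let piecewise (l : R) (g : R -> N) (D : set R) (x y : N) : Prop :=
  [/\ [/\ 0 < l, g 0 = x & g t @[t --> l^'-] --> y],
      [/\ finite_set D, (forall u, D u -> T <= u < l) &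
        forall u v, D u -> D v -> u != v -> T <= `|u - v|],
      (forall t, 0 <= t < l -> g s @[s --> t^'+] --> g t) /\
      (forall t, 0 < t < l -> ~ D t -> g s @[s --> t^'-] --> g t),
      forall t s, 0 <= t -> t <= s -> s < l ->
        (forall u, t < u -> u <= s -> g s @[s --> u^'-] --> g u) ->
        g s = psi (s - t) (g t) &
      forall u, D u -> exists2 z, g t @[t --> u^'-] --> z & mdist (g u) z < e].

Lemma piecewise_pseudo_orbit l g D x y :
  piecewise l g D x y -> pseudo_orbit psi T e l g.
Proof.
move=> [[l0 _ _] [Dfin DT sep] [rc lc] flw jmp]; split=> //; exists D; split=> //.
- split=> // t tl nD; have tl' : 0 <= t < l by case/andP: tl => /ltW -> ->.
  apply/cvg_mdistP => d d0.
  have /cvg_within_mdistP/(_ _ d0)[d1 d10 d1P] := rc t tl'.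
  have /cvg_within_mdistP/(_ _ d0)[d2 d20 d2P] := lc t tl nD.
  apply/nbhs_ballP; exists (Num.min d1 d2) => [|s] /=.
    by rewrite lt_min d10.
  rewrite distrC lt_min => /andP[s1 s2].
  by case: (ltgtP s t) => [st|ts|->]; [exact: d2P|exact: d1P|rewrite mdistxx].
- move=> t s /andP[t0 ts] sl /subspace_continuousP cont; apply: flw => // u tu us.
  have us' : `[t, s]%classic u by rewrite /= in_itv /= (ltW tu).
  have := cont u us' => gu.
  apply: (@cvg_within_eq _ _ `[t, s]%classic _ g _ _ (u - t)) gu.
    by rewrite subr_gt0.
  move=> w; rewrite ltr_norml => /andP[wt _] wu; split=> //.
  rewrite /= in_itv /=; apply/andP; split; first by lra.
  exact: ltW (lt_le_trans wu us).
Qed.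

Lemma piecewise_flow p z : 0 < p ->
  piecewise p (psi^~ z) set0 z (psi p z).
Proof.
move=> p0; split=> //.
- by split=> //; [exact: flow0|exact: flow_cvg].
- by split=> [t _|t _ _]; exact: flow_cvg.
- by move=> t s _ _ _ _; rewrite -flowD subrK.
Qed.

Lemma piecewise_cons l g D x x1 y t0 : T <= t0 -> mdist (psi t0 x) x1 < e ->
  piecewise l g D x1 y ->
  piecewise (l + t0) (fun s => if s < t0 then psi s x else g (s - t0))
    (t0 |` [set u + t0 | u in D]) x y.
Proof.
move=> Tt0 xx1 [[l0 gx1 gy] [Dfin DT sep] [rc lc] flw jmp].
have T0 := T_gt0.
have t0_gt0 : 0 < t0 by exact: lt_le_trans Tt0.
set h := fun s => _.
have hl A u : u < t0 -> h @ within A (nbhs u) --> h u.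
  move=> ut; rewrite {2}/h ut.
  apply: (@cvg_within_eq _ _ A _ (psi^~ x) _ _ (t0 - u)); last exact: flow_cvg.
    by rewrite subr_gt0.
  move=> s; rewrite ltr_norml => /andP[_ su] As; split=> //.
  by rewrite /h ifT //; lra.
have hright u : 0 <= u -> g s @[s --> u^'+] --> g u ->
    h s @[s --> (u + t0)^'+] --> h (u + t0).
  move=> u0 gu; rewrite {2}/h ifF ?addrK; last by apply/negbTE; rewrite -leNgt; lra.
  apply: (@cvg_within_shift _ _ (fun s => u < s) _ g _ _ _ 1) gu => // s _ us.
  rewrite /h ifF ?ltrBrDr //; apply/negbTE; rewrite -leNgt.
  by apply: le_trans (ltW us); rewrite lerDr.
have hleft u (z : N) : 0 < u -> g s @[s --> u^'-] --> z ->
    h s @[s --> (u + t0)^'-] --> z.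
  move=> u0 gu.
  apply: (@cvg_within_shift _ _ (fun s => s < u) _ g _ _ _ u) gu => // s.
  rewrite ltr_norml => /andP[su _] us.
  by rewrite /h ifF ?ltrBlDr //; apply/negbTE; rewrite -leNgt; lra.
have hE u : 0 <= u -> h (u + t0) = g u.
  by move=> u0; rewrite /h ifF ?addrK //; apply/negbTE; rewrite -leNgt; lra.
have ht0 : h t0 = x1 by rewrite -(add0r t0) hE.
have ht0l : h s @[s --> t0^'-] --> psi t0 x.
  apply: (@cvg_within_eq _ _ (fun s => s < t0) _ (psi^~ x) _ _ 1) => [//|s _ st|].
    by rewrite /h st.
  exact: flow_cvg.
split.
- split; first by rewrite addr_gt0.
    by rewrite /h t0_gt0 flow0.
  exact: hleft.
- split.
  + by rewrite finite_setU; split; [exact: finite_set1|exact: finite_image].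
  + move=> u [->|[v /DT/andP[Tv vl] <-]]; first by rewrite Tt0 ltrDr.
    by rewrite ltrD2r vl andbT; lra.
  + have sep0 u : D u -> T <= `|u + t0 - t0|.
      by move=> /DT/andP[Tu _]; rewrite addrK ger0_norm //; lra.
    move=> u v [->|[u' Du' <-]] [->|[v' Dv' <-]].
    * by rewrite eqxx.
    * by rewrite distrC => _; exact: sep0.
    * by move=> _; exact: sep0.
    * by rewrite (inj_eq (addIr t0)) opprD addrACA subrr addr0; exact: sep.
- split=> t.
    move=> /andP[tt tl]; have [|tt0] := ltP t t0; first exact: hl.
    rewrite -(subrK t0 t); apply: hright; first by rewrite subr_ge0.
    by apply: rc; rewrite subr_ge0 tt0 /= ltrBlDr.
  move=> /andP[tt tl] nD; have [|tt0] := ltP t t0; first exact: hl.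
  have {tt0} tt0 : t0 < t.
    by rewrite lt_neqAle tt0 andbT; apply/eqP => tE; apply: nD; left.
  rewrite -{1}(subrK t0 t); apply: hleft; first by rewrite subr_gt0.
  rewrite -[t in h t](subrK t0 t) hE ?subr_ge0 ?ltW //.
  apply: lc; first by rewrite subr_gt0 tt0 ltrBlDr.
  by move=> Dt; apply: nD; right; exists (t - t0) => //; rewrite subrK.
- have flow_right t s : 0 <= t -> t <= s -> s < l ->
      (forall u, t + t0 < u -> u <= s + t0 -> h s @[s --> u^'-] --> h u) ->
      h (s + t0) = psi (s - t) (h (t + t0)).
    move=> tt ts sl cont; rewrite !hE ?(le_trans tt) //; apply: flw => // u tu us.
    have u0 : 0 < u by exact: le_lt_trans tu.
    have := cont (u + t0); rewrite ltrD2r lerD2r (hE _ (ltW u0)) => /(_ tu us) hu.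
    apply: (@cvg_within_eq _ _ (fun s => s < u) _ (fun s => h (s + t0)) _ _ u) => //.
      by move=> w; rewrite ltr_norml => /andP[wu _] wu'; split=> //; rewrite hE //; lra.
    rewrite -{2}(addrK t0 u).
    apply: (@cvg_within_shift _ _ (fun s => s < u + t0)
      (fun s => s < u) h (fun s => h (s + t0)) (- t0) _ 1) => //.
    by move=> w _; rewrite opprK ltrD2r.
  move=> t s tt ts sl cont.
  have [st|st] := ltP s t0.
    by rewrite /h st (le_lt_trans ts) // -flowD subrK.
  have [t_lt|t_ge] := ltP t t0; last first.
    have [tt' ts' sl'] : [/\ 0 <= t - t0, t - t0 <= s - t0 & s - t0 < l].
      by split; lra.
    have := flow_right _ _ tt' ts' sl'; rewrite !subrK => -> //.
    by rewrite opprB addrA subrK.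
  (* Left continuity at [t0] makes the jump there trivial, so the flow relation extends across
     it. *)
  have x1E : x1 = psi t0 x.
    rewrite -ht0; apply: (cvg_unique (@metric_hausdorff _ N)) ht0l.
    exact: cont.
  have [ts' sl'] : 0 <= s - t0 /\ s - t0 < l by split; lra.
  have := flow_right _ _ (lexx 0) ts' sl'.
  rewrite add0r subrK ht0 subr0 => -> //.
    by rewrite x1E -flowD subrK /h t_lt -flowD subrK.
  by move=> u tu us; apply: cont => //; exact: lt_trans tu.
- move=> u [->|[v Dv <-]].
    by exists (psi t0 x) => //; rewrite ht0 metric_sym.
  have v0 : 0 < v by have /andP[Tv _] := DT v Dv; lra.
  have [z gz vz] := jmp v Dv; exists z; first exact: hleft.
  by rewrite hE // ltW.
Qed.

(** A piece of orbit of duration [p > 0] is appended, because a pseudo-orbit has positive length and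
    its end is a left limit. *)
Lemma reach_pseudo_orbit n x z p : 0 < p -> reach (step e) n x z ->
  exists l g, [/\ pseudo_orbit psi T e l g, g 0 = x &
    g t @[t --> l^'-] --> psi p z].
Proof.
move=> p0 xz.
suff [l [g [D gP]]] : exists l g D, piecewise l g D x (psi p z).
  by exists l, g; have [[_ -> gy] _ _ _ _] := gP; split=> //;
    exact: piecewise_pseudo_orbit gP.
elim: n x xz => [x ->|n IH x /reachSl[x1 [t [Tt _ xx1]] /IH[l [g [D gP]]]]].
  by exists p, (psi^~ z), set0; exact: piecewise_flow.
by eexists _, _, _; exact: piecewise_cons xx1 gP.
Qed.

End ToPseudoOrbit.

(** A pseudo-orbit cannot end with a jump. The last jump is redirected to [psi (- p) y] for a small
    [p], whence the flow leads to [y]; this costs the factor [2]. *)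
Lemma chain_pseudo_orbit e x y : 0 < e -> chain e x y ->
  exists l g, [/\ pseudo_orbit psi T (2 * e) l g, g 0 = x &
    g t @[t --> l^'-] --> y].
Proof.
move=> e0 [n [w xw [t [Tt tT wy]]]].
have [p p0 py] : exists2 p, 0 < p & mdist y (psi (- p) y) < e.
  have /cvg_within_mdistP/(_ e e0)[d d0 dP] := @flow_cvg _ _ psi setT y 0.
  exists (d / 2); first by rewrite divr_gt0.
  rewrite -{1}(flow0 psi y); apply: dP => //.
  by rewrite subr0 normrN gtr0_norm ?divr_gt0 //; lra.
have xz : reach (step (2 * e)) n.+1 x (psi (- p) y).
  exists w; first by apply: reach_le xw; lra.
  by exists t; split=> //; rewrite mulrDl mul1r; exact: mdist_ltD py.
have [l [g [gP gx gy]]] := reach_pseudo_orbit p0 xz.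
by exists l, g; split=> //; rewrite -flowD subrr flow0 in gy.
Qed.

End PseudoOrbitChains.

(** * Polyhedral cones *)

Section Cone.
Variables (R : realFieldType) (V : lmodType R).
Implicit Types (G : seq V) (u v : V) (l : V -> R).

Inductive cone G : V -> Prop :=
| cone0 : cone G 0
| cone_cons k g v : 0 <= k -> g \in G -> cone G v -> cone G (k *: g + v).

(** Stated for bare functions, so as to cover bundled forms and evaluations at homology classes
    alike. *)
Definition linear_form l := forall k u v, l (k *: u + v) = k * l u + l v.

Lemma linear_form0 l : linear_form l -> l 0 = 0.
Proof. by move=> /(_ (-1) 0 0); rewrite scaler0 addr0 mulN1r addNr. Qed.

Lemma linear_formD l u v : linear_form l -> l (u + v) = l u + l v.
Proof. by move=> ll; have := ll 1 u v; rewrite scale1r mul1r. Qed.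

Lemma linear_formZ l k u : linear_form l -> l (k *: u) = k * l u.
Proof. by move=> ll; have := ll k u 0; rewrite addr0 linear_form0 // addr0. Qed.

Lemma cone_mem G g : g \in G -> cone G g.
Proof.
move=> gG; rewrite -[g]addr0 -[g in g + _]scale1r.
by apply: cone_cons gG (cone0 _).
Qed.

Lemma coneD G u v : cone G u -> cone G v -> cone G (u + v).
Proof.
move=> uG vG; elim: uG => [|k g w k0 gG _ IH]; first by rewrite add0r.
by rewrite -addrA; exact: cone_cons.
Qed.

Lemma coneZ G k v : 0 <= k -> cone G v -> cone G (k *: v).
Proof.
move=> k0; elim=> [|k' g w k'0 gG _ IH]; first by rewrite scaler0; exact: cone0.
by rewrite scalerDr scalerA; apply: cone_cons => //; exact: mulr_ge0.
Qed.

Lemma cone_sub G (A : V -> Prop) :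
  A 0 -> (forall u v, A u -> A v -> A (u + v)) ->
  (forall k u, 0 <= k -> A u -> A (k *: u)) ->
  (forall g, g \in G -> A g) -> forall v, cone G v -> A v.
Proof.
move=> A0 AD AZ AG v; elim=> [//|k g w k0 gG _ Aw].
by apply: AD Aw; apply: AZ => //; exact: AG.
Qed.

(* One step of the double description method. *)
Lemma cone_halfspace G l : linear_form l ->
  exists G', forall v, cone G' v <-> cone G v /\ 0 <= l v.
Proof.
move=> ll; pose P := [seq g <- G | 0 <= l g]; pose Q := [seq g <- G | l g < 0].
pose G' := P ++ [seq l g *: h - l h *: g | g <- P, h <- Q].
have mix g h : l (l g *: h - l h *: g) = 0.
  by rewrite -scaleNr linear_formD // !linear_formZ // mulNr mulrC subrr.
exists G' => v; split.
  apply: (cone_sub (A := fun v => cone G v /\ 0 <= l v)).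
  - by split; [exact: cone0|rewrite linear_form0].
  - move=> u w [uG lu] [wG lw]; split; first exact: coneD.
    by rewrite linear_formD // addr_ge0.
  - move=> k u k0 [uG lu]; split; first exact: coneZ.
    by rewrite linear_formZ // mulr_ge0.
  move=> g; rewrite mem_cat => /orP[|/allpairsP[[a b] /=]].
    by rewrite mem_filter => /andP[lg /cone_mem].
  rewrite !mem_filter => -[/andP[la aG] /andP[lb bG] ->].
  split; last by rewrite mix.
  rewrite -scaleNr; apply: coneD; apply: coneZ; rewrite ?oppr_ge0 ?(ltW lb) //;
    exact: cone_mem.
have PG' u : cone P u -> cone G' u.
  apply: (cone_sub (A := cone G')) (@cone0 _) (@coneD _) (@coneZ _) _ _ => g gP.
  by apply: cone_mem; rewrite mem_cat gP.
have PQG' p q : cone P p -> cone Q q -> cone G' (l p *: q - l q *: p).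
  move=> Pp; move: q.
  apply: (cone_sub (A := fun q => cone G' (l p *: q - l q *: p))).
  - rewrite linear_form0 // scaler0 scale0r subr0; exact: cone0.
  - move=> u w uG wG; rewrite linear_formD // scalerDr scalerDl opprD addrACA.
    exact: coneD.
  - move=> k u k0 uG; rewrite linear_formZ // scalerA (mulrC (l p)) -!scalerA -scalerBr.
    exact: coneZ.
  move=> h hQ; move: p Pp.
  apply: (cone_sub (A := fun p => cone G' (l p *: h - l h *: p))).
  - rewrite linear_form0 // scaler0 scale0r subr0; exact: cone0.
  - move=> u w uG wG; rewrite linear_formD // scalerDr scalerDl opprD addrACA.
    exact: coneD.
  - move=> k u k0 uG; rewrite linear_formZ // scalerA (mulrC (l h)) -!scalerA -scalerBr.
    exact: coneZ.
  move=> g gP; apply: cone_mem; rewrite mem_cat; apply/orP; right.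
  by apply/allpairsP; exists (g, h).
move=> [vG lv].
(* The generators are sorted by the sign of [l]. Unless [q = 0], the strict sign of [l q] forces
   [0 < l p], which permits the division below. *)
have [p [q [Pp Qq vE q0]]] : exists p q,
    [/\ cone P p, cone Q q, v = p + q & l q < 0 \/ q = 0].
  elim: vG {lv} => [|k g w k0 gG _ [p [q [Pp Qq -> q0]]]].
    by exists 0, 0; split; [exact: cone0|exact: cone0|rewrite addr0|right].
  have [lg|lg] := leP 0 (l g).
    exists (k *: g + p), q; split; rewrite ?addrA //.
    by apply: cone_cons => //; rewrite mem_filter lg.
  have [->|k_neq0] := eqVneq k 0; first by exists p, q; rewrite scale0r add0r.
  exists p, (k *: g + q); split; rewrite ?(addrCA (k *: g)) //.
    by apply: cone_cons => //; rewrite mem_filter lg.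
  have lkg : k * l g < 0 by rewrite pmulr_rlt0 // lt_neqAle eq_sym k_neq0.
  left; rewrite ll; case: q0 => [lq|->]; first by rewrite -[0]addr0 ltrD.
  by rewrite linear_form0 // addr0.
case: q0 => [lq|q0]; last by rewrite vE q0 addr0; exact: PG'.
have lp : 0 < l p.
  by move: lv; rewrite vE linear_formD // addrC => lv; lra.
have -> : v = (l p)^-1 *: (l p *: q - l q *: p) + ((l p + l q) / l p) *: p.
  rewrite vE scalerBr !scalerA mulVf ?gt_eqF // scale1r -addrA addrC; congr (_ + _).
  rewrite -scaleNr -scalerDl [X in X *: p](_ : _ = 1) ?scale1r //.
  by field; rewrite gt_eqF.
apply: coneD; apply: coneZ; rewrite ?invr_ge0 ?(ltW lp) //; first exact: PQG'.
  by rewrite divr_ge0 // ?(ltW lp) //; move: lv; rewrite vE linear_formD.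
exact: PG'.
Qed.

(** Induction on the forms: a vector [w] with [l i w != 0] splits off a line, generated as a cone by
    [w] and [- w], and leaves the kernel of [l i]. *)
Lemma cone_space n (l : 'I_n -> V -> R) : (forall i, linear_form (l i)) ->
  (forall v, (forall i, l i v = 0) -> v = 0) ->
  exists G, forall v, cone G v.
Proof.
move=> ll lV.
suff main (s : seq 'I_n) (W : V -> Prop) :
    (forall k u v, W u -> W v -> W (k *: u + v)) ->
    (forall v, W v -> (forall i, i \in s -> l i v = 0) -> v = 0) ->
    exists G, forall v, W v -> cone G v.
  have [//||G GP] := main (enum 'I_n) (fun=> True); last by exists G => v; exact: GP.
  by move=> v _ lv; apply: lV => i; apply: lv; rewrite mem_enum.
elim: s W => [|i s IH] W Wlin WV.
  by exists [::] => v Wv; rewrite (WV v) //; exact: cone0.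
have [[w Ww liw]|iN] := pselect (exists2 w, W w & l i w != 0); last first.
  apply: IH => // v Wv lv; apply: WV => // j; rewrite inE => /orP[/eqP ->|/lv //].
  by apply/eqP; apply: contra_notT iN => liv; exists v.
have [||G GP] := IH (fun v => W v /\ l i v = 0).
- move=> k u v [Wu lu] [Wv lv]; split; first exact: Wlin.
  by rewrite ll lu lv mulr0 addr0.
- move=> v [Wv liv] lv; apply: WV => // j; rewrite inE => /orP[/eqP -> //|]; exact: lv.
exists [:: w, - w & G] => v Wv.
pose k := l i v / l i w.
have -> : v = (`|k| + k) / 2 *: w + ((`|k| - k) / 2 *: (- w) + ((- k) *: w + v)).
  rewrite scalerN -scaleNr !addrA -!scalerDl -[LHS]add0r; congr (_ + _).
  by rewrite [X in X *: w](_ : _ = 0) ?scale0r //; lra.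
have knorm : 0 <= `|k| + k /\ 0 <= `|k| - k.
  by have := ler_norm k; have := ler_norm (- k); rewrite normrN => ? ?; split; lra.
apply: cone_cons; [by rewrite divr_ge0 //; case: knorm|by rewrite inE eqxx|].
apply: cone_cons; [by rewrite divr_ge0 //; case: knorm|by rewrite !inE eqxx orbT|].
have : cone G (- k *: w + v).
  apply: GP; split; first exact: Wlin.
  by rewrite ll mulNr /k divfK // addNr.
apply: (cone_sub (A := cone _)) (@cone0 _) (@coneD _) (@coneZ _) _ _ => g gG.
by apply: cone_mem; rewrite !inE gG !orbT.
Qed.

(** The half of the Minkowski-Weyl theorem that turns inequalities into generators, imposing one
    half-space at a time. *)
Lemma cone_inequalities (I : eqType) (G : seq V) (l : I -> V -> R) (s : seq I) :
  (forall i, linear_form (l i)) ->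
  exists G', forall v, cone G' v <-> cone G v /\ forall i, i \in s -> 0 <= l i v.
Proof.
move=> ll; elim: s => [|i s [G1 G1P]].
  by exists G => v; split=> [vG|[]//]; split.
have [G2 G2P] := cone_halfspace G1 (ll i); exists G2 => v.
split=> [/G2P[/G1P[vG vs] vi]|[vG vs]].
  by split=> // j; rewrite inE => /orP[/eqP -> //|]; exact: vs.
apply/G2P; split; last by apply: vs; rewrite inE eqxx.
by apply/G1P; split=> // j js; apply: vs; rewrite inE js orbT.
Qed.

End Cone.

(** * Coverings *)
Lemma eq_lift (R : realType) (N M : metricType R) (p : N -> M) (g h : R -> N) :
  isometric_on_small_balls p -> continuous g -> continuous h ->
  (forall t, p (g t) = p (h t)) -> g 0 = h 0 -> forall t, g t = h t.
Proof.
move=> [r r0 rP] gc hc gh g0 t.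
have Rc : connected [set: R] by apply/connected_intervalP.
(* The coincidence set is open because [p] is injective on small balls, and closed because distinct
   values stay apart nearby. *)
apply: (@connected_setT _ [set t | g t = h t] Rc); first by exists 0.
- rewrite openE => u /= ghu.
  have /cvg_mdistP/(_ _ r0) gu := gc u; have /cvg_mdistP/(_ _ r0) hu := hc u.
  apply: filterS2 gu hu => v; rewrite -ghu => gv hv; apply: mdist_positivity.
  by rewrite -(rP (g u)) ?ballEmdist //= gh mdistxx.
rewrite -[X in closed X]setCK; apply: open_closedC.
rewrite openE => u /= ghu.
have d0 : 0 < mdist (g u) (h u) / 2 by rewrite divr_gt0 // mdist_gt0; apply/eqP.
have /cvg_mdistP/(_ _ d0) gu := gc u; have /cvg_mdistP/(_ _ d0) hu := hc u.
apply: filterS2 gu hu => v gv hv ghv; rewrite -ghv metric_sym in hv.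
by have := mdist_ltD gv hv; rewrite -splitr ltxx.
Qed.

Section Cohomology.
Variables (R : realType) (M : topologicalType) (a : cohomology1 R M).

Lemma cohom1D c d : a (c + d) = a c + a d.
Proof. by have := valP a; rewrite unfold_in => /asboolP; apply. Qed.

Lemma cohom1_0 : a 0 = 0.
Proof. by apply: (addrI (a 0)); rewrite -cohom1D !addr0. Qed.

Lemma cohom1N c : a (- c) = - a c.
Proof. by apply: (addrI (a c)); rewrite -cohom1D !subrr cohom1_0. Qed.

Lemma cohom1Mn c n : a (c *+ n) = a c *+ n.
Proof. by elim: n => [|n IH]; rewrite ?mulr0n ?cohom1_0 // !mulrS cohom1D IH. Qed.

Lemma linear_eval (c : homology1 R M) :
  linear_form (fun b : cohomology1 R M => b c : R).
Proof. by []. Qed.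

End Cohomology.

Section Cover.
Variables (R : realType) (M : metricType R) (Mh : univ_abelian_cover M).
Hypothesis M_compact : compact [set: M].
Local Notation p := (uac_proj Mh).
Local Notation H := (homology1 R M).

Lemma proj_act (c : H) (x : Mh) : p (uac_act c x) = p x.
Proof. by apply/esym; apply/uac_fibre; exists c. Qed.

Lemma proj_surj m : exists x, p x = m.
Proof. by have [x _ <-] := @uac_surj _ _ Mh m I; exists x. Qed.

Lemma cover_proj_open (U : set Mh) : open U -> open (p @` U).
Proof.
move=> oU; rewrite openE => _ [x Ux <-].
have [_ /(_ (p x)) [W [oW Wx [S [SE _ SV]]]]] := uac_covering Mh.
have : (p @^-1` W) x by [].
rewrite SE => -[V SV' Vx]; have [oV _ /(_ (U `&` V)) opW] := SV V SV'.
rewrite /interior nbhsE /=; exists (p @` (U `&` V)).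
  split; last by exists x.
  by apply: opW; [exact: openI|exact: subIsetr].
by move=> _ [y [Uy _] <-]; exists y.
Qed.

Lemma cover_cocompact (eta : Mh -> R) : (forall x, 0 < eta x) ->
  exists s : seq Mh, forall x,
  exists z c, z \in s /\ mdist z (uac_act c x) < eta z.
Proof.
move=> eta0; pose B z := [set y | mdist z y < eta z].
(* Along the filter of finite lists ordered by inclusion, the near-covering form of compactness
   yields one list that serves all of [M]. *)
pose F := filter_from setT (fun s : seq Mh => [set s' : seq Mh | {subset s <= s'}]).
have FF : Filter F.
  apply: filter_from_filter => [|s s' _ _]; first by exists [::].
  by exists (s ++ s') => // w sub; split=> x xs; apply: sub; rewrite mem_cat xs ?orbT.
have /compact_near_coveringP cov := M_compact.
have [m _|s _ sP] := cov _ F (fun s m => exists2 z, z \in s & (p @` B z) m) FF.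
  have [x <-] := proj_surj m.
  exists (p @` B x, [set s' : seq Mh | {subset [:: x] <= s'}]) => /=.
    split; last by exists [:: x].
    apply: open_nbhs_nbhs; split; first by apply: cover_proj_open; exact: open_mball.
    by exists x => //; rewrite /B /= mdistxx.
  by move=> [m' s] [/= xm xs]; exists x => //; apply: xs; rewrite mem_head.
exists s => x; have [//|z zs [y zy]] := sP s _ (p x) I.
by move=> /esym /uac_fibre[c yE]; exists z, c; rewrite -yE.
Qed.

Lemma cover_discrete : exists2 r : R, 0 < r &
  forall (x : Mh) (c : H), mdist x (uac_act c x) < r -> c = 0.
Proof.
have [r r0 rP] := uac_local_isometry Mh; exists r => // x c xc.
have := rP x x (uac_act c x); rewrite !ballEmdist /= mdistxx => /(_ r0 xc).
rewrite proj_act mdistxx => /esym/mdist_positivity xE.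
exact: (@uac_free _ _ Mh c x (esym xE)).
Qed.

Definition cover_action : deck_action Mh H :=
  DeckAction (@uac_act0 _ _ Mh) (@uac_actD _ _ Mh) (@uac_isometry _ _ Mh)
    cover_cocompact (s2valP (cid2 cover_discrete)) (s2valP' (cid2 cover_discrete)).

Variables (phi : flow R M) (phih : flow R Mh) (T : R).
Hypothesis T_gt0 : 0 < T.
Hypothesis phih_lift : lifts p phih phi.

Lemma flow_path_continuous (N : metricType R) (psi : flow R N) x :
  continuous (psi^~ x).
Proof.
move=> t; have /cvg_mdistP psi_t := @flow_cvg _ _ psi setT x t.
by apply/cvg_mdistP => e /psi_t; rewrite near_withinE; apply: filterS => s; exact.
Qed.

(** Both sides lift the same orbit of [phi] and agree at time [0]. *)
Lemma phih_act t (c : H) x : phih t (uac_act c x) = uac_act c (phih t x).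
Proof.
move: t; apply: (eq_lift (uac_local_isometry Mh)).
- exact: flow_path_continuous.
- move=> t; apply/cvg_mdistP => e e0.
  have /cvg_mdistP/(_ _ e0) := @flow_path_continuous _ phih x t.
  by apply: filterS => s; rewrite uac_isometry.
- by move=> t; rewrite proj_act !phih_lift proj_act.
- by rewrite !flow0.
Qed.

(** * The quotient covering attached to a class *)

Section ModKer.
Variables (a : cohomology1 R M) (Ma : cover_mod_ker Mh a) (phia : flow R Ma).
Hypothesis phia_lift : lifts (cmk_proj Ma) phia phi.
Local Notation q := (cmk_quot Ma).

Lemma quot_continuous : continuous q.
Proof.
by apply/continuousP => U /cmk_open.
Qed.

Lemma quot_flow t x : q (phih t x) = phia t (q x).
Proof.
move: t; apply: (eq_lift (cmk_local_isometry Ma)).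
- move=> t; apply: (@continuous_comp _ _ _ (phih^~ x) q).
    exact: flow_path_continuous.
  exact: quot_continuous.
- exact: flow_path_continuous.
- by move=> t; rewrite phia_lift !cmk_projE phih_lift.
- by rewrite !flow0.
Qed.

Lemma quot_unif e : 0 < e -> exists2 d, 0 < d &
  forall x y, mdist x y < d -> mdist (q x) (q y) < e.
Proof.
move=> e0; have e2 : 0 < e / 2 by rewrite divr_gt0.
apply: (cocompact_unif (act := cover_action) (P := fun d x => forall y, mdist x y < d ->
  mdist (q x) (q y) < e)) => [d d' x d'0 dd' dP y xy|d c x dP y xy|z].
- by apply: dP; exact: lt_le_trans xy dd'.
- rewrite -[y](actKV cover_action c) cmk_isometry; apply: dP.
  by rewrite -mdist_actl.
have /cvg_mdistP/(_ _ e2)/nbhs_mdistP[d d0 dP] := @quot_continuous z.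
exists (d / 2) => [|x zx y xy]; first by rewrite divr_gt0.
rewrite (splitr e); apply: (@mdist_ltD _ _ (q z)).
  by rewrite metric_sym; apply: dP; apply: lt_le_trans zx _; lra.
by apply: dP; rewrite (splitr d); exact: mdist_ltD xy.
Qed.

Lemma cover_proj_open_unif e : 0 < e -> exists2 d, 0 < d &
  forall x m, mdist (p x) m < d -> exists2 y, p y = m & mdist x y < e.
Proof.
move=> e0; have e2 : 0 < e / 2 by rewrite divr_gt0.
apply: (cocompact_unif (act := cover_action) (P := fun d x => forall m,
  mdist (p x) m < d -> exists2 y, p y = m & mdist x y < e))
  => [d d' x d'0 dd' dP m xm|d c x dP m|z].
- by apply: dP; exact: lt_le_trans xm dd'.
- rewrite proj_act => /dP[y <- xy]; exists (uac_act c y); rewrite ?proj_act //.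
  by rewrite uac_isometry.
have /open_mdistP/(_ (p z))[|d d0 dP] := cover_proj_open (@open_mball _ _ z (e / 2)).
  by exists z => //=; rewrite mdistxx.
have d2 : 0 < d / 2 by rewrite divr_gt0.
have pc : continuous p by exact: (uac_covering Mh).1.
have /cvg_mdistP/(_ _ d2)/nbhs_mdistP[d' d'0 d'P] := pc z.
exists (Num.min (d / 2) (Num.min d' (e / 2))) => [|x].
  by rewrite !lt_min d2 d'0.
rewrite !lt_min => /and3P[_ zx zx'] m; rewrite lt_min => /andP[xm _].
have [|y /= zy <-] := dP m.
  by rewrite (splitr d); apply: mdist_ltD xm; exact: d'P.
exists y => //; rewrite (splitr e); apply: mdist_ltD zy.
by rewrite metric_sym.
Qed.

(** A point [y] near [x] is found over the projection of [y'] to [M]. Then [q y] and [y'] are both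
    near [q x] and have the same projection, hence coincide. *)
Lemma quot_lift e : 0 < e -> exists2 d, 0 < d &
  forall x y', mdist (q x) y' < d -> exists2 y, q y = y' & mdist x y < e.
Proof.
move=> e0; have [r r0 rP] := cmk_local_isometry Ma.
have [d1 d10 d1P] := quot_unif r0.
have m0 : 0 < Num.min e d1 by rewrite lt_min e0.
have [d d0 dP] := cover_proj_open_unif m0.
exists (Num.min d r) => [|x y']; first by rewrite lt_min d0.
have [y0 _ <-] := @cmk_surj _ _ _ _ Ma y' I.
rewrite lt_min => /andP[xyd xyr].
have pxy : mdist (p x) (p y0) < d.
  by rewrite -!(cmk_projE Ma) (rP (q x)) // ballEmdist //= mdistxx.
have [y py] := dP x _ pxy; rewrite lt_min => /andP[xye xyd1].
exists y => //; apply: mdist_positivity.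
rewrite -(rP (q x)) ?ballEmdist //=; last exact: d1P.
by rewrite !cmk_projE py mdistxx.
Qed.

(** A pseudo-orbit of the quotient gives a chain there, which lifts step by step; the ends of a
    lifted loop differ by a class in the kernel of [a]. Conversely, chains project. *)
Lemma recurrent_quot x : recurrent phia T (q x) <->
  recurrent_mod cover_action phih T [set c | a c = 0] x.
Proof.
split=> [xrec e e0|xrec e e0].
  have [d1 d10 d1P] := reach_flow_loop (act := cover_action) T_gt0 phih_act e0.
  have [d d0 dP] := quot_lift d10.
  have [l [g [gP gx gl]]] := xrec d d0.
  have [n [w [s [qxw s0 xw]]]] := pseudo_orbit_reach_end T_gt0 gP gl.
  have [w' w'E xw'] : exists2 w', q w' = w & reach (step phih T d1) n x w'.
    rewrite gx in qxw; elim: n w {xw} qxw => [w <-|n IH w [v /IH[v' <- xv']]].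
      by exists x.
    move=> [t [Tt tT vw]]; rewrite -quot_flow in vw.
    have [w' w'E vw'] := dP _ _ vw; exists w' => //; exists v' => //.
    by exists t.
  have : q x = q (phih s w') by rewrite quot_flow w'E.
  move=> /cmk_quotE[c ac sc]; have [k xk] := d1P _ _ _ _ c xw' s0 sc.
  by exists (c *+ k.+1) => //=; rewrite cohom1Mn ac mul0rn.
have e2 : 0 < e / 2 by rewrite divr_gt0.
have [d d0 dP] := quot_unif e2.
have [c /= ac xc] := xrec d d0.
have qc : q (uac_act c x) = q x.
  by apply/esym/cmk_quotE; exists c.
have : chain phia T (e / 2) (q x) (q x).
  rewrite -[in X in chain _ _ _ _ X]qc; apply: linked_map xc => u v.
  by move=> [t [Tt tT uv]]; exists t; split=> //; rewrite -quot_flow; exact: dP.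
move=> /(chain_pseudo_orbit T_gt0 e2)[l [g [gP gx gl]]].
by exists l, g; rewrite mulrC divfK // in gP.
Qed.

End ModKer.

(** Along [n + 1] repetitions of the loop an equivariant [f] grows by [n + 1] times [a c], whereas
    the quasi-Lyapunov constant [C] does not depend on [n]. *)
Lemma quasi_lyapunov_loops (a : cohomology1 R M) : quasi_lyapunov phih T a ->
  exists2 e, 0 < e & forall x c, chain phih T e x (uac_act c x) -> a c <= 0.
Proof.
move=> aQL.
have [f f_cont f_act] := equivariant_exists cover_action (cohom1D a).
have [C [e [C0 e0 fP]]] := aQL f f_cont f_act.
have e2 : 0 < e / 2 by rewrite divr_gt0.
exists (e / 2) => // x c xc.
have aC n : (a c : R) *+ n.+1 <= C.
  have /(chain_pseudo_orbit T_gt0 e2)[l [g [gP gx gl]]] :=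
    chain_loopMn (act := cover_action) phih_act n xc.
  rewrite mulrC divfK // in gP.
  have : f (uac_act (c *+ n.+1) x) <= f x + C.
    (* A pseudo-orbit only tends to its end, so the inequality is passed to the limit. *)
    have fg : f (g t) @[t --> l^'-] --> f (uac_act (c *+ n.+1) x).
      exact: (cvg_comp g f gl (f_cont _)).
    apply: ler_cvg_to fg (@cvg_cst _ (f x + C) _ _ _) _.
    have l0 : 0 < l by case: gP.
    near=> t; rewrite -lerBlDr -gx; apply: fP gP _ _.
    by apply/andP; split; near: t; [exact: nbhs_left_ge|exact: nbhs_left_lt].
  by rewrite f_act cohom1Mn lerD2l.
rewrite leNgt; apply/negP => ac.
have := archi_boundP (divr_ge0 C0 (ltW ac)); rewrite ltr_pdivrMr // => Cac.
have := le_lt_trans (aC (Num.bound (C / a c))) Cac.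
by rewrite -[_ *+ _.+1]mulr_natl ltr_pM2r // ltr_nat ltnNge leqnSn.
Unshelve. all: by end_near.
Qed.

(** A sufficient test by finitely many classes; its finiteness leaves room for the perturbation in
    [face_loop_class]. *)
Lemma loops_quasi_lyapunov e : 0 < e -> exists2 S : seq H,
  (forall c, c \in S -> exists x, chain phih T e x (uac_act c x)) &
  forall a : cohomology1 R M, (forall c, c \in S -> a c <= 0) ->
    quasi_lyapunov phih T a.
Proof.
move=> e0.
have [S Sloop [d d0 SP]] := loop_classes (act := cover_action) T_gt0 phih_act e0.
exists S => // a aS f f_cont f_act.
have [C C0 CP] := SP f a f_cont (cohom1D a) f_act aS.
have [C1 C10 C1P] := equivariant_flow_bounded (act := cover_action) T_gt0 phih_act
  f_cont (cohom1D a) f_act.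
exists (C1 + C), d; split; rewrite ?addr_ge0 // => l g gP t /andP[t0 tl].
have [n [y [s [gy s0 sT ->]]]] := pseudo_orbit_reach T_gt0 gP d0 t0 tl.
have := CP _ _ _ gy; have := C1P y s s0 sT; rewrite ler_norml => /andP[_].
by lra.
Qed.

End Cover.

(** * Faces of the quasi-Lyapunov cone *)

Section Interior.
Variables (R : realType) (M : topologicalType).
Implicit Types (a b : cohomology1 R M) (F : set (cohomology1 R M)).

Lemma cohom1_line_continuous a b :
  continuous (fun s : R => (1 + s) *: a - s *: b).
Proof.
apply: continuous_comp_initial => s.
(* [pointwise_cvgP] requires a topology on the index type. *)
apply/(@pointwise_cvgP (discrete_topology (homology1 R M)) R^o) => c.
have : (fun u : R => (1 + u) * a c - u * b c) @ s --> (1 + s) * a c - s * b c.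
  apply: cvgB; apply: cvgM; try exact: cvg_cst; last exact: cvg_id.
  by apply: cvgD; [exact: cvg_cst|exact: cvg_id].
exact.
Qed.

(** A relative interior point has room in every direction of the span, in particular in the
    direction away from [b]. *)
Lemma rel_interior_past F a b : F b -> rel_interior F a ->
  exists2 s : R, 0 < s & F ((1 + s) *: a - s *: b).
Proof.
move=> Fb [Fa]; rewrite near_withinE => Fnear.
have : \forall s \near (0 : R), linear_span F ((1 + s) *: a - s *: b) ->
    F ((1 + s) *: a - s *: b).
  have := @cohom1_line_continuous a b 0.
  by rewrite /continuous_at addr0 scale1r scale0r subr0 => /(_ _ Fnear).
move=> /nbhs_ballP[d /= d0 dP]; exists (d / 2); first by rewrite divr_gt0.
apply: dP; first by rewrite -ball_normE /= sub0r normrN gtr0_norm; lra.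
exists 2%N, (fun i : 'I_2 => if i == 0 then 1 + d / 2 else - (d / 2)),
  (fun i : 'I_2 => if i == 0 then a else b); split.
  by move=> i; case: ifP.
by rewrite big_ord_recl big_ord1 /= scaleNr.
Qed.

End Interior.

Section Faces.
Variables (R : realType) (M : metricType R) (Mh : univ_abelian_cover M).
Variables (phi : flow R M) (phih : flow R Mh) (T : R).
Hypothesis M_compact : compact [set: M].
Hypothesis phih_lift : lifts (uac_proj Mh) phih phi.
Hypothesis T_gt0 : 0 < T.
Local Notation p := (uac_proj Mh).
Local Notation QL := (quasi_lyapunov phih T).
Implicit Types (F : set (cohomology1 R M)).

Definition annihilator F : set (homology1 R M) :=
  [set c | forall b, F b -> b c = 0].

Definition face_recurrent F : set M :=
  p @` recurrent_mod (cover_action Mh M_compact) phih T (annihilator F).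

Let phi_act t c x : phih t (cover_action Mh M_compact c x) =
  cover_action Mh M_compact c (phih t x).
Proof. exact: phih_act phih_lift _ _ _. Qed.

(** Closedness descends from the covering because the projection is open and the set upstairs is
    deck-invariant. *)
Lemma face_recurrent_compact F : compact (face_recurrent F).
Proof.
apply: (@subclosed_compact _ _ [set: M]) => // m mF.
have [x xm] := proj_surj Mh m; exists x => //.
apply: (recurrent_mod_closed phi_act) => d d0.
have : nbhs m (p @` [set y | mdist x y < d]).
  apply: open_nbhs_nbhs; split; first by apply: cover_proj_open; exact: open_mball.
  by exists x => //=; rewrite mdistxx.
move=> /mF[_ [[y yF <-] [y' /= xy' /uac_fibre[c yE]]]].
exists y' => //; rewrite -(actK (cover_action Mh M_compact) c y').
by apply: (recurrent_mod_act phi_act) => //; rewrite -[_ c y']yE.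
Qed.

Lemma face_recurrent_flow F t m :
  face_recurrent F m -> face_recurrent F (phi t m).
Proof.
move=> [x xF <-]; exists (phih t x); last exact: phih_lift.
exact: (recurrent_mod_flow phi_act).
Qed.

(** Finitely many evaluations separate cohomology classes, so the cone is finitely generated. Each
    generator has its own scale, and the smallest one serves all nonnegative combinations. *)
Lemma polyhedral_loops : polyhedral_cone QL -> exists2 e, 0 < e &
  forall a, QL a -> forall x c, chain phih T e x (uac_act c x) -> a c <= 0.
Proof.
move=> [n [l QLE]].
(* [finite_generation] needs a base point; an empty covering carries no loops at all. *)
have [[x0]|noX] := pselect (inhabited Mh); last first.
  by exists 1 => // a _ x; case: noX.
have [s sP] := finite_generation (cover_action Mh M_compact)
  (@uac_connected _ _ Mh) x0.
have [|v v0|G GP] := @cone_space _ _ (size s)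
  (fun i (b : cohomology1 R M) => b (nth 0 s i)).
- by move=> i; exact: linear_eval.
- apply: val_inj; apply/funext => c; apply: (sP v (cohom1D v)) => d ds.
  rewrite -index_mem in ds; rewrite -(v0 (Ordinal ds)) /= nth_index //.
  by rewrite -index_mem.
have [|G' G'P] := @cone_inequalities R _ _ G (fun i => l i) (enum 'I_n).
  by move=> i k u v; exact: linearP.
have QLG a : QL a <-> cone G' a.
  rewrite QLE; split=> [la|/G'P[_ la] i]; last by apply: la; rewrite mem_enum.
  by apply/G'P; split=> // i _; exact: la.
have [|g gG'|e e0 eP] := @seq_pos R _ G' (fun g e => forall x c,
    chain phih T e x (uac_act c x) -> g c <= 0).
- by move=> g e e' e'0 ee' ge x c xc; apply: (ge x); exact: chain_le xc.
- apply: (quasi_lyapunov_loops M_compact T_gt0 phih_lift).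
  by apply/QLG; exact: cone_mem.
exists e => // a /QLG aG'; move: a aG'.
apply: (cone_sub (A := fun a : cohomology1 R M =>
  forall x c, chain phih T e x (uac_act c x) -> a c <= 0)) => //.
- move=> u v uA vA x c xc; have := uA x c xc; have := vA x c xc.
  by rewrite (linear_formD _ _ (linear_eval c)) => ? ?; lra.
- move=> k u k0 uA x c xc; rewrite (linear_formZ _ _ (linear_eval c)).
  by rewrite mulr_ge0_le0 //; exact: uA xc.
Qed.

Lemma face_recurrent_interior F a (Ma : cover_mod_ker Mh a) (phia : flow R Ma) :
  polyhedral_cone QL -> is_face QL F -> lifts (cmk_proj Ma) phia phi ->
  rel_interior F a -> alpha_recurrent phia T = face_recurrent F.
Proof.
move=> /polyhedral_loops[e0 e00 e0P] [l [_ FE]] phia_lift aF.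
apply/seteqP; split=> m.
  move=> [y yrec <-]; have [x _ xy] := @cmk_surj _ _ _ _ Ma y I.
  rewrite -xy in yrec *; rewrite cmk_projE; exists x => //.
  have /(recurrent_quot M_compact T_gt0 phih_lift phia_lift) xrec := yrec.
  move=> e e_gt0; have m0 : 0 < Num.min e e0 by rewrite lt_min e_gt0.
  have [c /= ac xc] := xrec _ m0; exists c; last first.
    by apply: chain_le xc; rewrite ge_min lexx.
  have QLc b : QL b -> b c <= 0.
    move=> bQL; apply: (e0P b bQL x); apply: chain_le xc.
    by rewrite ge_min lexx orbT.
  (* As [a c = 0], the point beyond [a] takes the value [- s * b c] at [c]. It lies in the cone, so
     this is nonpositive and [0 <= b c]. *)
  move=> b Fb; have [s s0 Fs] := rel_interior_past Fb aF.
  have FQL b' : F b' -> QL b' by rewrite FE => -[].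
  apply/eqP; rewrite eq_le QLc /=; last exact: FQL.
  have := QLc _ (FQL _ Fs); rewrite -scaleNr linear_eval.
  rewrite (linear_formZ _ _ (linear_eval c)) ac mulr0 add0r mulNr oppr_le0.
  by rewrite pmulr_rge0.
move=> [x xF <-]; exists (cmk_quot Ma x); last exact: cmk_projE.
apply/(recurrent_quot M_compact T_gt0 phih_lift phia_lift) => e e0'.
have [c cF xc] := xF e e0'; exists c => //; apply: cF.
by case: aF.
Qed.

(* If no loop class strict on [F] vanished on [F'], one could push a generic
   point [b] of [F'] beyond the face, away from [a], without leaving QL. *)
Lemma face_loop_class F F' e : polyhedral_cone QL -> is_face QL F ->
  is_face QL F' -> F' `<` F -> 0 < e ->
  exists x c a, [/\ annihilator F' c, F a, a c < 0 & chain phih T e x (uac_act c x)].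
Proof.
move=> /polyhedral_loops[e0 e00 e0P] [l [_ FE]] [l' [l'QL F'E]] [F'F nFF'] e_gt0.
have [a Fa F'a] : exists2 a, F a & ~ F' a.
  apply: contrapT => aN; apply: nFF' => a Fa.
  by apply: contrapT => F'a; apply: aN; exists a.
have FQL b : F b -> QL b by rewrite FE => -[].
have F'QL b : F' b -> QL b by move=> /F'F /FQL.
have l'lin : linear_form l' by move=> k u v; exact: linearP.
have l'a : 0 < l' a.
  rewrite lt_neqAle l'QL ?andbT; last exact: FQL.
  by apply/eqP => la; apply: F'a; rewrite F'E; split; [exact: FQL|rewrite /= -la].
have m0 : 0 < Num.min e e0 by rewrite lt_min e_gt0.
have [S Sloop SQL] := loops_quasi_lyapunov M_compact T_gt0 phih_lift m0.
have QLS b c : QL b -> c \in S -> b c <= 0.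
  move=> bQL /Sloop[x xc]; apply: (e0P b bQL x c); apply: chain_le xc.
  by rewrite ge_min lexx orbT.
have evalD c (u v : cohomology1 R M) : (u + v) c = u c + v c by [].
have evalZ c k (u : cohomology1 R M) : (k *: u) c = k * u c by [].
apply: contrapT => noloop.
have aS c : c \in S -> annihilator F' c -> a c = 0.
  move=> cS cF'; apply/eqP; rewrite eq_le QLS //=; last exact: FQL.
  rewrite leNgt; apply/negP => ac; apply: noloop.
  have [x xc] := Sloop c cS; exists x, c, a; split=> //.
  by apply: chain_le xc; rewrite ge_min lexx.
have QL0 : QL 0 by apply: SQL => c _; rewrite (linear_form0 (linear_eval c)).
have F'0 : F' 0 by rewrite F'E; split=> //=; rewrite linear_form0.
have F'D u v : F' u -> F' v -> F' (u + v).
  rewrite F'E => -[uQL /= lu] [vQL /= lv]; split; last first.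
    by rewrite /= linear_formD // lu lv addr0.
  apply: SQL => c cS; rewrite evalD.
  by have := QLS u c uQL cS; have := QLS v c vQL cS; lra.
(* [b] is a sum of points of [F'], one for each class of [S] that does not vanish on [F']. All terms
   are nonpositive on [S], so nothing cancels. *)
have [b F'b bS] : exists2 b, F' b & forall c, c \in S -> b c = 0 -> annihilator F' c.
  have {noloop SQL aS Sloop} : forall c, c \in S -> forall b, F' b -> b c <= 0.
    by move=> c cS b /F'QL bQL; exact: QLS.
  elim: (S) => [|c s IH] cs; first by exists 0.
  have [d ds|b F'b bs] := IH; first by apply: cs; rewrite inE ds orbT.
  have [cF'|] := pselect (annihilator F' c).
    by exists b => // d; rewrite inE => /orP[/eqP ->|]; [|exact: bs].
  move=> /existsNP[b' /not_implyP[F'b' b'c]]; exists (b + b'); first exact: F'D.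
  have b'_le d : d \in c :: s -> b d <= 0 /\ b' d <= 0.
    by move=> ds; split; exact: cs.
  move=> d ds; have [bd b'd] := b'_le d ds; rewrite evalD => bb'.
  have {bb'} [bd0 b'd0] : b d = 0 /\ b' d = 0 by split; lra.
  move: ds; rewrite inE => /orP[/eqP dc|ds]; last exact: bs.
  by rewrite dc in b'd0.
have [c t t' t'0 t't + cS|c cS|t t0 tP] :=
    @seq_pos R _ S (fun c t => c \in S -> b c - t * a c <= 0).
- move=> /(_ cS) tle; apply: le_trans tle.
  by rewrite lerD2l lerN2 ler_wnM2r //; apply: QLS => //; exact: FQL.
- have bc := QLS b c (F'QL b F'b) cS.
  have ac := QLS a c (FQL a Fa) cS.
  have [bc0|bc0] := eqVneq (b c) 0.
    by exists 1 => // _; rewrite bc0 (aS c cS (bS c cS bc0)) mulr0 subrr.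
  have bc_lt0 : b c < 0 by rewrite lt_neqAle bc0.
  have ac1 : 0 < 1 - a c by lra.
  (* For this [t] one has [b c - t * a c = - t]; the summand [1] keeps the denominator positive even
     if [a c = 0]. *)
  have q0 : 0 < - b c / (1 - a c) by rewrite divr_gt0 // oppr_gt0.
  exists (- b c / (1 - a c)) => // _.
  rewrite (_ : _ - _ = - (- b c / (1 - a c))); first by rewrite oppr_le0 ltW.
  by field; rewrite gt_eqF.
(* The contradiction: [l'] is nonnegative on the cone, but it vanishes at [b] and is positive at
   [a]. *)
have btaQL : QL (- t *: a + b).
  by apply: SQL => c cS; rewrite linear_eval mulNr addrC; exact: tP.
have := l'QL _ btaQL; rewrite l'lin.
have l'b : l' b = 0 by move: F'b; rewrite F'E => -[].
by rewrite l'b addr0 mulNr oppr_ge0 pmulr_rle0 // leNgt l'a.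
Qed.

Lemma face_recurrent_proper F F' : polyhedral_cone QL -> is_face QL F ->
  is_face QL F' -> F' `<` F -> face_recurrent F `<` face_recurrent F'.
Proof.
move=> QLpoly faceF faceF' F'F; have F'F_sub := F'F.1; split.
  move=> m [x xF <-]; exists x => // e /xF[c cF xc].
  by exists c => // b /F'F_sub; exact: cF.
move=> sub; have [e0 e00 e0P] := polyhedral_loops QLpoly.
have F_QL b : F b -> QL b by have [l [_ ->]] := faceF; case.
have annD c d : annihilator F c -> annihilator F d -> annihilator F (c + d).
  by move=> cF dF b Fb; rewrite cohom1D cF ?dF ?addr0.
have ann0 : annihilator F 0 by move=> b _; exact: cohom1_0.
have [|d d0 dP] := chain_reverse T_gt0 phi_act (K := annihilator F)
    (K' := annihilator F') ann0 annD _ e00.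
  move=> w wF'; have [|w' w'F /uac_fibre[c wE]] := sub (p w); first by exists w.
  by rewrite wE; exact: (recurrent_mod_act phi_act).
have [x [c [a [cF' Fa ac xc]]]] := face_loop_class QLpoly faceF faceF' F'F d0.
have [k kF ck] := dP x c cF' xc.
(* Translation by [- c] yields a loop of class [k - c], on which [a] takes the positive value
   [- a c]. *)
have : chain phih T e0 x (uac_act (k - c) x).
  have := chain_act phi_act (- c) ck.
  by rewrite actK /= -uac_actD addrC.
move=> /(e0P a (F_QL a Fa)); rewrite cohom1D cohom1N (kF a Fa) add0r.
by rewrite oppr_le0 leNgt ac.
Qed.

End Faces.

Theorem theorem2 (R : realType) (M : metricType R) (phi : flow R M)
    (Mh : univ_abelian_cover M) (phih : flow R Mh)
    (Ma : forall a : cohomology1 R M, cover_mod_ker Mh a)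
    (phia : forall a : cohomology1 R M, flow R (Ma a))
    (T : R) :
  manifold_with_boundary R M ->
  compact [set: M] ->
  connected [set: M] ->
  lifts (uac_proj Mh) phih phi ->
  (forall a, lifts (cmk_proj (Ma a)) (phia a) phi) ->
  0 < T ->
  let QL := quasi_lyapunov phih T in
  closed QL ->
  polyhedral_cone QL ->
  exists RF : set (cohomology1 R M) -> set M,
    forall F, is_face QL F ->
      [/\ compact (RF F),
          forall t x, RF F x -> RF F (phi t x),
          forall a, QL a -> rel_interior F a ->
            alpha_recurrent (phia a) T = RF F
        & forall F', is_face QL F' -> F' `<` F -> RF F `<` RF F'].
Proof.
move=> _ M_compact _ phih_lift phia_lift T_gt0 QL _ QLpoly.
exists (face_recurrent phih T M_compact) => F faceF; split.
- exact: face_recurrent_compact.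
- exact: face_recurrent_flow.
- by move=> a _; exact: face_recurrent_interior.
- by move=> F'; exact: face_recurrent_proper.
Qed.
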